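(* Let $K$ be a field of characteristic $0$, let $f_0,f_1,f_2,\ldots\in K$, and let $$F(\rho)=\frac{f_0}{\rho}+f_1+f_2\rho+f_3\rho^2+\cdots .$$ For $i\ge 1$ define $$\gamma_i(x)=\frac{(-1)^i}{i!}\sum_{\substack{C\in\mathcal{RCCD}\\ b(C)\ge i}}x^{|C|}f_C\,f_{b(C)-i}\in K[[x]],$$ and let $G(x,L)=1-\sum_{n\ge1}\gamma_n(x)L^n$. Then $G$ solves the Dyson-Schwinger equation $$G(x,L)=1-x\,G(x,\partial_{-\rho})^{-1}\,(e^{-L\rho}-1)F(\rho)\,\Big|_{\rho=0}.$$
   Context: Chord diagrams. A rooted chord diagram of degree (size) $n\ge1$ consists of $2n$ points $p_1,\dots,p_{2n}$ numbered counterclockwise on a circle, with $p_1$ the root, together with a partition of these points into $n$ pairs called chords; equivalently it is a perfect matching of $\{1,\dots,2n\}$. Two chords $\{p_a,p_c\}$ and $\{p_{a'},p_{c'}\}$ with $a<c$, $a'<c'$, $a<a'$ cross if $a<a'<c<c'$. The diagram is connected if the graph whose vertices are the chords and whose edges are the crossing pairs is connected. $\mathcal{RCCD}$ is the set of rooted connected chord diagrams, and $|C|$ is the number of chords of $C$. The counterclockwise order on chords is the order by smaller endpoint index. A chord is terminal if it crosses no chord that is larger in the counterclockwise order. The intersection order on the chords of a connected diagram is defined recursively: the counterclockwise-smallest chord comes first; after deleting it, the remaining chords split into connected components (of the crossing graph), which are listed by increasing counterclockwise-smallest chord; then come the chords of the first component in the intersection order of that component, then those of the second component, and so on. Label the chords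 $1,\dots,n$ in the intersection order. Let $t_1<t_2<\dots<t_{k+1}$ be the labels of the terminal chords. Then $b(C)=t_1$, and with the gaps $\delta_i=t_{i+1}-t_i$ ($1\le i\le k$), $$f_C=f_0^{\,n-k-1}f_{\delta_1}f_{\delta_2}\cdots f_{\delta_k}.$$ Meaning of the equation. Everything is formal. $G(x,\partial_{-\rho})=1-\sum_{n\ge1}\gamma_n(x)\,(-1)^n\frac{d^n}{d\rho^n}$ is the operator obtained by substituting $\frac{d}{d(-\rho)}$ for $L$; its inverse is the geometric series $\sum_{m\ge0}\left(\sum_{n\ge1}\gamma_n(x)(-1)^n\frac{d^n}{d\rho^n}\right)^m$ (well defined since $\gamma_n(x)$ is divisible by $x^n$). It is applied to $(e^{-L\rho}-1)F(\rho)$, a power series in $\rho$ with coefficients polynomial in $L$, and the result is evaluated at $\rho=0$. *)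

(* Defs.v *)
From HB Require Import structures.
From mathcomp Require Import all_boot all_order all_algebra.

Set Implicit Arguments.
Unset Strict Implicit.
Unset Printing Implicit Defensive.

Import GRing.Theory.

(******************************************************************************)
(* Rooted connected chord diagrams                                            *)
(******************************************************************************)

(* The point p_(i+1) is i : 'I_n.*2, and a chord {p_a, p_c} with a < c is the *)
(* pair (a, c); the condition a < c is part of chord_diagram.                 *)
Notation chord n := ('I_n.*2 * 'I_n.*2)%type.

Section ChordDiagrams.
Variable n : nat.
Implicit Types (c d : chord n) (S C : {set chord n}).

Definition chord_diagram C :=
  [forall c in C, c.1 < c.2]
  && [forall p : 'I_n.*2, #|[set c in C | (p == c.1) || (p == c.2)]| == 1].

Definition cross c d : bool :=
  [&& c.1 < d.1, d.1 < c.2 & c.2 < d.2] || [&& d.1 < c.1, c.1 < d.2 & d.2 < c.2].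

Definition cross_in S : rel (chord n) :=
  [rel c d | [&& c \in S, d \in S & cross c d]].

Definition component S c := [set d in S | connect (cross_in S) c d].

Definition connected S := [forall c in S, forall d in S, connect (cross_in S) c d].

(* Diagrams have size at least 1. *)
Definition rccd C := [&& 0 < n, chord_diagram C & connected C].

Definition ccw_enum S : seq (chord n) := sort (fun c d => c.1 <= d.1) (enum S).

Definition components S : seq {set chord n} :=
  [seq component S c |
    c <- ccw_enum S & [forall d in component S c, c.1 <= d.1]].

(* The recursion removes at least one chord at each level, so the fuel #|S|   *)
(* used in intersection_order is sufficient (intersection_order_mem).         *)
Fixpoint intersection_rec fuel S : seq (chord n) :=
  if fuel isn't k.+1 then [::] else
  if ccw_enum S isn't r :: _ then [::] else
  r :: flatten [seq intersection_rec k T | T <- components (S :\ r)].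

Definition intersection_order S := intersection_rec #|S| S.

Definition terminal C c := ~~ [exists d in C, (c.1 < d.1) && cross c d].

(* Labels start at 1; this list is increasing.                                *)
Definition terminal_labels C : seq nat :=
  [seq (index c (intersection_order C)).+1 |
    c <- intersection_order C & terminal C c].

Definition bdiag C : nat := head 0 (terminal_labels C).

Definition gaps C : seq nat :=
  pairmap (fun s t => t - s) (bdiag C) (behead (terminal_labels C)).

Lemma mem_ccw_enum S c : (c \in ccw_enum S) = (c \in S).
Proof. by rewrite mem_sort mem_enum. Qed.

Lemma ccw_enum_uniq S : uniq (ccw_enum S).
Proof. by rewrite sort_uniq enum_uniq. Qed.

Lemma cross_in_sym S : connect_sym (cross_in S).
Proof.
apply: sym_connect_sym => c d; rewrite /cross_in /= /cross orbC.
by rewrite andbCA.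
Qed.

Lemma in_component S c d :
  (d \in component S c) = (d \in S) && connect (cross_in S) c d.
Proof. by rewrite in_set. Qed.

Lemma component_sub S c : component S c \subset S.
Proof. by apply/subsetP => d; rewrite in_component => /andP[]. Qed.

Lemma mem_intersection_rec k S c :
  #|S| <= k -> (c \in intersection_rec k S) = (c \in S).
Proof.
elim: k S c => [|k IHk] S c /=.
  by rewrite leqn0 cards_eq0 => /eqP->; rewrite inE.
move=> leSk; case defS: (ccw_enum S) => [|r s].
  by rewrite -mem_ccw_enum defS.
have rS : r \in S by rewrite -mem_ccw_enum defS mem_head.
have leS'k : #|S :\ r| <= k by move: leSk; rewrite (cardsD1 r) rS.
rewrite inE; case: eqVneq => [->|neq_cr] //=.
have -> : (c \in S) = (c \in S :\ r) by rewrite !inE neq_cr.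
apply/flatten_mapP/idP => [[T /mapP[e _ ->]]|cS].
  rewrite IHk; first exact/subsetP/component_sub.
  exact/(leq_trans _ leS'k)/subset_leq_card/component_sub.
have cc : c \in component (S :\ r) c by rewrite in_component cS connect0.
case: (arg_minnP (fun d : chord n => val d.1) cc) => e ec emin.
have [eS ce] : e \in S :\ r /\ connect (cross_in (S :\ r)) c e.
  by apply/andP; rewrite -in_component.
have eqc : component (S :\ r) e = component (S :\ r) c.
  by apply/setP => x; rewrite !in_component (same_connect (@cross_in_sym _) ce).
exists (component (S :\ r) e).
  apply: map_f; rewrite mem_filter mem_ccw_enum eS andbT eqc.
  by apply/forall_inP.
rewrite IHk ?eqc //.
exact/(leq_trans _ leS'k)/subset_leq_card/component_sub.
Qed.

Lemma intersection_order_mem S c : (c \in intersection_order S) = (c \in S).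
Proof. exact: mem_intersection_rec. Qed.

Lemma intersection_rec_uniq k S :
  {in S &, injective fst} -> #|S| <= k -> uniq (intersection_rec k S).
Proof.
elim: k S => [//|k IHk] S injS leSk; rewrite [intersection_rec _ _]/=.
case defS: (ccw_enum S) => [//|r s].
have rS : r \in S by rewrite -mem_ccw_enum defS mem_head.
have leS'k : #|S :\ r| <= k by move: leSk; rewrite (cardsD1 r) rS.
have subS := component_sub (S :\ r).
have leT c : #|component (S :\ r) c| <= k.
  by apply: leq_trans leS'k; apply/subset_leq_card/subS.
have sub1 x : x \in S :\ r -> x \in S by rewrite inE => /andP[].
rewrite cons_uniq; apply/andP; split.
  apply/flatten_mapP => -[T /mapP[e _ ->]].
  by rewrite mem_intersection_rec // => /(subsetP (subS e)); rewrite !inE eqxx.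
rewrite /components -map_comp.
set l := [seq c <- _ | _].
have lP e : e \in l -> e \in S :\ r /\
    {in component (S :\ r) e, forall d, e.1 <= d.1}.
  by rewrite mem_filter mem_ccw_enum => /andP[/forall_inP].
have : uniq l by rewrite filter_uniq // ccw_enum_uniq.
elim: l lP => [//|e l IHl] lP /andP[el ul].
rewrite /= cat_uniq IHl ?andbT //; last by move=> x xl; apply: lP; rewrite inE xl orbT.
rewrite IHk //= => [|x y xC yC]; last first.
  by apply: injS; apply/sub1/(subsetP (subS e)).
apply/hasPn => x /flatten_mapP[e' e'l] /=; rewrite !mem_intersection_rec //.
rewrite !in_component => /andP[_ ce'x]; apply/negP => /andP[_ cex].
have [eS emin] := lP _ (mem_head e l).
have [e'S e'min] : e' \in S :\ r /\ _ := lP _ (@mem_behead _ (e :: l) e' e'l).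
have cee' : connect (cross_in (S :\ r)) e e'.
  by apply: connect_trans cex _; rewrite cross_in_sym.
suff ee' : e = e' by rewrite ee' e'l in el.
apply: injS; rewrite ?sub1 //; apply/val_inj/eqP; rewrite eqn_leq.
by rewrite emin ?e'min ?in_component ?eS ?e'S // cross_in_sym.
Qed.

Lemma chord_diagram_fst_inj C : chord_diagram C -> {in C &, injective fst}.
Proof.
case/andP => _ /forallP mC c d cC dC eqcd.
have /cards1P[e eC] := mC c.1.
have : c \in [set e] by rewrite -eC inE cC eqxx.
have : d \in [set e] by rewrite -eC inE dC eqcd eqxx.
by rewrite !inE => /eqP-> /eqP->.
Qed.

Lemma card_chord_diagram C : chord_diagram C -> #|C| = n.
Proof.
case/andP => /forall_inP ltC /forallP mC; apply: double_inj.
pose E (c : chord n) := [set p | (p == c.1) || (p == c.2)].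
have: \sum_(c in C) #|E c| = \sum_(p < n.*2) #|[set c in C | p \in E c]|.
  under eq_bigr do rewrite -sum1_card big_mkcond /=.
  rewrite exchange_big; apply: eq_bigr => p _ /=.
  by rewrite -sum1dep_card big_mkcondr.
rewrite [RHS](eq_bigr (fun=> 1)) => [|p _]; last first.
  by rewrite -(eqP (mC p)); apply: eq_card => c; rewrite !inE.
rewrite sum1_card card_ord => Esum; apply: etrans Esum.
rewrite (eq_bigr (fun=> 2)) ?sum_nat_const ?muln2 // => c /ltC lt_c.
have -> : E c = [set c.1; c.2] by apply/setP => p; rewrite !inE.
by rewrite cards2 neq_ltn lt_c.
Qed.

Lemma size_intersection_order C :
  chord_diagram C -> size (intersection_order C) = n.
Proof.
move=> dC; have injC := chord_diagram_fst_inj dC.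
rewrite -(card_uniqP _).
  apply: etrans (card_chord_diagram dC).
  by apply: eq_card => c; rewrite intersection_order_mem.
exact: intersection_rec_uniq.
Qed.

Lemma bdiag_le C : chord_diagram C -> bdiag C <= n.
Proof.
move=> dC; rewrite /bdiag.
case E: (terminal_labels C) => [//|t s] /=.
have: t \in terminal_labels C by rewrite E mem_head.
case/mapP => c; rewrite mem_filter => /andP[_ cC] ->.
by rewrite -[X in _ <= X](size_intersection_order dC) index_mem.
Qed.

End ChordDiagrams.

Local Open Scope ring_scope.

(******************************************************************************)
(* Formal series                                                              *)
(* A series in x is the sequence of its coefficients. A series in x whose     *)
(* coefficients are power series in rho over V is H : nat -> nat -> V, where  *)
(* H j m is the coefficient of x^j rho^m. Here V = {poly K} is K[L].          *)
(******************************************************************************)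

Section Series.
Variables (K : fieldType) (V : lmodType K).
Implicit Types (H : nat -> nat -> V) (g : nat -> nat -> K).

(* The infinite sum of the u n for n >= a, when u n is divisible by x^n: only *)
(* the terms with n <= j have a nonzero coefficient of x^j (xsumE).           *)
Definition xsum (a : nat) (u : nat -> nat -> nat -> V) j m : V :=
  \sum_(a <= n < j.+1) u n j m.

Definition xscale (c : nat -> K) H j m : V := \sum_(i < j.+1) c i *: H (j - i)%N m.

Definition drho (h : nat -> V) m : V := h m.+1 *+ m.+1.

(* For g n in x^n K[[x]], the operator sum_(n >= 1) g n (-1)^n d^n/drho^n.    *)
Definition dop g H : nat -> nat -> V :=
  xsum 1 (fun n => xscale (fun i => (-1) ^+ n * g n i)
                          (fun j => iter n drho (H j))).

(* G(x, d/d(-rho)) for G(x, L) = 1 - sum_(n >= 1) g n L^n, and its inverse.   *)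
Definition Gop g H j m : V := H j m - dop g H j m.

Definition Gop_inv g H : nat -> nat -> V := xsum 0 (fun n => iter n (dop g) H).

Definition xconst (h : nat -> V) j m : V := if j is 0 then h m else 0.

Definition xdivisible g := forall n j, (j < n)%N -> g n j = 0.

Lemma xsumE a u j m N : (forall n i k, (i < n)%N -> u n i k = 0) ->
  (j < N)%N -> xsum a u j m = \sum_(a <= n < N) u n j m.
Proof.
move=> u0 ltjN; rewrite /xsum; case: (leqP a j.+1) => [leaj|ltja].
  rewrite (big_cat_nat leaj ltjN) /= [X in _ = _ + X]big_nat_cond.
  by rewrite [X in _ = _ + X]big1 ?addr0 // => i /andP[/andP[/u0->]].
rewrite big_geq ?(ltnW ltja) // big_nat_cond big1 // => i /andP[/andP[lei _] _].
by rewrite u0 // (leq_trans _ lei) // ltnW.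
Qed.

Lemma dop_term0 g H n j m : xdivisible g -> (j < n)%N ->
  xscale (fun i => (-1) ^+ n * g n i) (fun i => iter n drho (H i)) j m = 0.
Proof.
move=> g0 ltjn; rewrite /xscale big1 // => i _.
by rewrite g0 ?mulr0 ?scale0r // (leq_trans (ltn_ord i)).
Qed.

Lemma iter_drho_ext n (h1 h2 : nat -> V) :
  h1 =1 h2 -> iter n drho h1 =1 iter n drho h2.
Proof. by move=> h12; elim: n => [//|n IHn] m /=; rewrite /drho IHn. Qed.

Lemma iter_drho_sum n I (r : seq I) (h : I -> nat -> V) m :
  iter n drho (fun m => \sum_(i <- r) h i m) m = \sum_(i <- r) iter n drho (h i) m.
Proof. by elim: n m => [//|n IHn] m /=; rewrite /drho IHn sumrMnl. Qed.

(* The coefficient of x^j in dop g H involves only those of x^i in H, i < j.  *)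
Lemma dop_ext g H1 H2 j : xdivisible g ->
  (forall i, (i < j)%N -> H1 i =1 H2 i) -> dop g H1 j =1 dop g H2 j.
Proof.
move=> g0 H12 m; rewrite /dop /xsum !big_nat; apply: eq_bigr => n /andP[n0 _].
apply: eq_bigr => -[[|i] lti] _ /=; first by rewrite g0 // mulr0 !scale0r.
congr (_ *: _); apply: iter_drho_ext; apply: H12.
by case: j lti => // j _; rewrite subSS ltnS leq_subr.
Qed.

Lemma dop_sum g I (r : seq I) (H : I -> nat -> nat -> V) j m :
  dop g (fun j m => \sum_(i <- r) H i j m) j m = \sum_(i <- r) dop g (H i) j m.
Proof.
rewrite /dop /xsum [RHS]exchange_big; apply: eq_bigr => n _.
rewrite /xscale [RHS]exchange_big; apply: eq_bigr => i _ /=.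
by rewrite iter_drho_sum scaler_sumr.
Qed.

Lemma iter_dop0 g H n j m : xdivisible g -> (j < n)%N -> iter n (dop g) H j m = 0.
Proof.
move=> g0; elim: n j m => [//|n IHn] j m ltjn /=.
rewrite (@dop_ext g _ (fun _ _ => \sum_(i <- [::] : seq nat) 0)) //.
  by rewrite dop_sum big_nil.
by move=> i ltij k; rewrite big_nil IHn // (leq_trans ltij).
Qed.

Lemma Gop_invK g H j m : xdivisible g -> Gop g (Gop_inv g H) j m = H j m.
Proof.
move=> g0; rewrite /Gop.
rewrite (@dop_ext g _ (fun i k => \sum_(0 <= n < j) iter n (dop g) H i k)) //; last first.
  by move=> i ltij k; apply: xsumE => // *; apply: iter_dop0.
by rewrite dop_sum /Gop_inv /xsum big_nat_recl //= addrK.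
Qed.

End Series.

(******************************************************************************)
(* The Dyson-Schwinger equation                                               *)
(******************************************************************************)

Section DysonSchwinger.
Variables (K : fieldType) (f : nat -> K).

Definition fdiag n (C : {set chord n}) : K :=
  f 0 ^+ (n - size (gaps C) - 1) * \prod_(d <- gaps C) f d.

(* gamma i j is the coefficient of x^j in gamma_i(x), for i >= 1.             *)
Definition gamma i j : K :=
  (-1) ^+ i / i`!%:R *
  \sum_(C : {set chord j} | rccd C && (i <= bdiag C)%N)
    fdiag C * f (bdiag C - i).

(* The coefficient of x^j L^l in G(x, L) = 1 - sum_(n >= 1) g n L^n.         *)
Definition green (g : nat -> nat -> K) (j l : nat) : K :=
  ((j == 0%N) && (l == 0%N))%:R - (if l is 0 then 0 else g l j).

(* The coefficient of rho^m in e^(- L rho) - 1.                               *)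
Definition expm1 m : {poly K} := if m is 0 then 0 else (m`!%:R)^-1 *: (- 'X) ^+ m.

(* The coefficient of rho^m in (e^(- L rho) - 1) F(rho): since                *)
(* rho F(rho) = sum_i (f i) rho^i, it is the coefficient of rho^(m+1) in      *)
(* (e^(- L rho) - 1) (rho F(rho)); that of rho^(-1) is (f 0) *: expm1 0 = 0.  *)
Definition kernelF m : {poly K} := \sum_(i < m.+2) f i *: expm1 (m.+1 - i).

(* The coefficient of x^j, a polynomial in L, in                              *)
(* 1 - x G(x, d/d(-rho))^-1 (e^(- L rho) - 1) F(rho) at rho = 0.              *)
Definition dse_rhs (g : nat -> nat -> K) (j : nat) : {poly K} :=
  (j == 0%N)%:R - (if j is i.+1 then Gop_inv g (xconst kernelF) i 0 else 0).

Lemma gamma_xdivisible : xdivisible gamma.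
Proof.
move=> i j ltji; rewrite /gamma big1 ?mulr0 // => C.
by case/andP=> /and3P[_ /bdiag_le leb _] /(leq_trans ltji); rewrite ltnNge leb.
Qed.

End DysonSchwinger.

(* Main.v *)
Require Import Defs.
From mathcomp Require Import all_boot all_order all_algebra.
From mathcomp Require Import zify ring.

Set Implicit Arguments.
Unset Strict Implicit.
Unset Printing Implicit Defensive.

Import GRing.Theory.

(* Put g_n = (-1)^n n! gamma_n and let Phi_b be the sum of x^|C| f_C over the  *)
(* C with b(C) = b, so that g_n = sum_b f_(b - n) Phi_b. Let C have at least  *)
(* two chords, and let D be the component, after deletion of the root, of the *)
(* chord starting at the second point. Then C is obtained by inserting a      *)
(* connected diagram C' (the other chords) into one of the 2 |D| - 1 gaps of  *)
(* D and moving the root of C' to the front. Moreover b(C) = b(D) + 1 and     *)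
(* f_C = f_D f_C' f_(b(C') - 1). Hence Phi_1 = x, and with                    *)
(* delta = 2 x d/dx - 1,                                                      *)
(*   Phi_(b+1) = g_1 delta Phi_b,   g_(n+1) = g_1 delta g_n    (b, n >= 1).   *)
(* Let Psi(z) = sum_k Phi_(k+1) z^k / k! and                                  *)
(* Gam(z) = 1 - sum_(n >= 1) g_n z^n / n!. Both satisfy d/dz = g_1 delta, so  *)
(* W = Psi Gam satisfies dW/dz = g_1 (delta - 1) W with W(0) = x, whence      *)
(* W = x. Thus the inverse of G(x, L) is the series                           *)
(* sum_k (Phi_(k+1) / x) (- L)^k / k!, and applying it to                     *)
(* (e^(- L rho) - 1) F(rho) gives back the series g_n.                        *)

(** * Crossing and order-preserving relabelling of points *)

(** The right-hand side involves the series H that the operator [G(x, d/d(-rho))] sends to the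
    kernel [(e^(- L rho) - 1) F(rho)], and the claim is that x H at rho = 0 is the sum of the
    gamma_n L^n. The operator is the identity minus terms raising the degree in x, so H is
    determined ([Gop_inj]) and it suffices to exhibit it. The candidate [solution] is the sum over k
    of (Phi_(k+1) / x) (d/drho)^k / k! applied to the kernel. It is the right H because Psi Gam = x
    ([euler_convolution], [Gop_solution]). At rho = 0 the sum of Phi_(k+1) against the kernel
    coefficients f_(k+1-l) (-1)^l / l! is gamma_l ([coef_solution]).

    What remains are the recursions for Phi_b and g_n ([coef_phi], [coef_gsum]), which come from the
    unique decomposition by insertion ([rccd_sum]). Every component left after deleting the root
    crosses the root, so one other than D cannot have points in two gaps of D: this would force it
    to cross D ([component_gap]). Thus all points off D, except the first, fill a single gap. There
    are 2 |D| - 1 gaps, whence the operator delta.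

    For the weight, D is the first component after the root, so the intersection order lists the
    root, then D, then C' without its root ([intersection_order_insert]). Terminality is inherited
    by every chord but the root. As the last chord of D is terminal ([last_flags]), the only new gap
    between terminal labels is b(C') - 1; summing over C' gives the factor g_1 ([insert_weight]). *)

Section ChordSets.
Variable n : nat.
Implicit Types (c d : chord n) (S T A B : {set chord n}).

Lemma crossC c d : cross c d = cross d c.
Proof. by rewrite /cross orbC. Qed.

Lemma connect_cross_sub S T c d :
  S \subset T -> connect (cross_in S) c d -> connect (cross_in T) c d.
Proof.
move=> /subsetP sST; apply: connect_sub => x y /and3P[xS yS xy].
by apply: connect1; rewrite /cross_in /= !sST.
Qed.

Lemma connect_component S c d :
  c \in S -> connect (cross_in S) c d -> connect (cross_in (component S c)) c d.
Proof.
move=> cS /connectP[s]; elim/last_ind: s d => [|s x IHs] d /=; first by move=> _ ->.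
rewrite rcons_path last_rcons => /andP[ps /and3P[lS xS lx]] ->.
have cl : connect (cross_in S) c (last c s) by apply/connectP; exists s.
apply: connect_trans (IHs _ ps erefl) (connect1 _).
rewrite /cross_in /= !in_component lS xS lx cl /= andbT.
by apply: connect_trans cl (connect1 _); rewrite /cross_in /= lS xS.
Qed.

Lemma component_connected S c : c \in S -> connected (component S c).
Proof.
move=> cS; apply/forall_inP => x; rewrite in_component => /andP[_ cx].
apply/forall_inP => y; rewrite in_component => /andP[_ cy].
apply: connect_trans (connect_component cS cy).
by rewrite cross_in_sym connect_component.
Qed.

Lemma cross_same_side (l h : nat) c d :
  c.1 < c.2 -> d.1 < d.2 -> cross c d ->
  (l < c.1 < h) = (l < c.2 < h) -> (l < d.1 < h) = (l < d.2 < h) ->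
  (l < c.1 < h) = (l < d.1 < h).
Proof. by rewrite /cross; lia. Qed.

(* A chord lying on one side of an interval crosses no chord of the other side. *)
Lemma connect_same_side S (l h : nat) c d :
  (forall e, e \in S -> e.1 < e.2) ->
  (forall e, e \in S -> (l < e.1 < h) = (l < e.2 < h)) ->
  c \in S -> connect (cross_in S) c d -> (l < c.1 < h) = (l < d.1 < h).
Proof.
move=> ltS sideS cS /connectP[s]; elim: s c cS => [|x s IHs] c cS /=; first by move=> _ ->.
move=> /andP[/and3P[_ xS cx] ps] dE; rewrite -(IHs x) //.
by rewrite (cross_same_side _ _ cx) ?ltS ?sideS.
Qed.

(** If no chord joined the inside of the interval to the outside, crossings could never lead from
    one side to the other. *)
Lemma connected_straddle S (l h : nat) c d :
  (forall e, e \in S -> e.1 < e.2) -> connected S -> c \in S -> d \in S ->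
  (l < c.1 < h) || (l < c.2 < h) -> ~~ ((l < d.1 < h) && (l < d.2 < h)) ->
  exists2 e, e \in S & (l < e.1 < h) != (l < e.2 < h).
Proof.
move=> ltS conS cS dS inc outd.
have [|none] := boolP [exists e in S, (l < e.1 < h) != (l < e.2 < h)].
  by case/exists_inP => e; exists e.
have side e : e \in S -> (l < e.1 < h) = (l < e.2 < h).
  by move=> eS; apply/eqP; apply: contraNT none => ne; apply/exists_inP; exists e.
have same : (l < c.1 < h) = (l < d.1 < h).
  have /forall_inP/(_ c cS)/forall_inP/(_ d dS) := conS.
  exact: (connect_same_side ltS side cS).
by move: inc outd; rewrite -!side // same orbb andbb => ->.
Qed.

Lemma ccw_enum_sorted S :
  {in S &, injective fst} -> sorted (fun c d => c.1 < d.1) (ccw_enum S).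
Proof.
move=> injS; have: sorted (fun c d => c.1 <= d.1) (ccw_enum S).
  by apply: sort_sorted => c d; apply: leq_total.
have: uniq (ccw_enum S) by apply: ccw_enum_uniq.
have: {subset ccw_enum S <= S} by move=> c; rewrite mem_ccw_enum.
case: (ccw_enum S) => [//|c s]; elim: s c => [//|d s IHs] c /= sub.
case/andP; rewrite inE negb_or => /andP[ncd _] us /andP[lecd ps].
apply/andP; split; last first.
  by apply: IHs => // x xs; apply: sub; rewrite inE xs orbT.
rewrite ltn_neqAle lecd andbT; apply: contra ncd => /eqP/val_inj eqcd.
by apply/eqP/injS => //; apply: sub; rewrite !inE eqxx ?orbT.
Qed.

(** A strictly sorted list is determined by its members; every computation of [ccw_enum] goes
    through this. *)
Lemma ccw_enum_unique S s :
  {in S &, injective fst} -> sorted (fun c d => c.1 < d.1) s -> s =i S ->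
  ccw_enum S = s.
Proof.
move=> injS srt eqS; apply: irr_sorted_eq (ccw_enum_sorted injS) srt _.
- by move=> x y z; apply: ltn_trans.
- by move=> x; apply: ltnn.
- by move=> x; rewrite mem_ccw_enum eqS.
Qed.

Lemma filter_ccw_enum S (P : pred (chord n)) :
  {in S &, injective fst} ->
  [seq c <- ccw_enum S | P c] = ccw_enum [set c in S | P c].
Proof.
move=> injS; apply/esym/ccw_enum_unique.
- by move=> x y; rewrite !inE => /andP[xS _] /andP[yS _]; apply: injS.
- apply: sorted_filter (ccw_enum_sorted injS).
  by move=> x y z; apply: ltn_trans.
- by move=> x; rewrite mem_filter mem_ccw_enum inE andbC.
Qed.

Lemma ccw_enum_cons S c :
  {in S &, injective fst} -> c \in S -> (forall d, d \in S -> c.1 <= d.1) ->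
  ccw_enum S = c :: ccw_enum (S :\ c).
Proof.
move=> injS cS minc; apply: ccw_enum_unique => //; last first.
  by move=> x; rewrite inE mem_ccw_enum !inE; case: eqVneq => [->|].
have injS' : {in S :\ c &, injective fst}.
  by move=> x y; rewrite !inE => /andP[_ xS] /andP[_ yS]; apply: injS.
rewrite /= path_min_sorted ?ccw_enum_sorted //; apply/allP => d.
rewrite mem_ccw_enum !inE => /andP[ndc dS]; rewrite ltn_neqAle minc // andbT.
by apply: contra ndc => /eqP/val_inj eqcd; apply/eqP/injS.
Qed.

Definition no_cross A B := forall c d, c \in A -> d \in B -> ~~ cross c d.

Lemma component_setUl A B c : no_cross A B -> connected A -> c \in A ->
  component (A :|: B) c = A.
Proof.
move=> ncAB conA cA; apply/setP => d; rewrite in_component.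
apply/andP/idP => [[_ /connectP[s]]|dA].
  elim: s c cA => [|x s IHs] c cA /=; first by move=> _ ->.
  move=> /andP[/and3P[_ xU cx] ps] dE; apply: IHs ps dE.
  by move: xU; rewrite inE => /orP[//|xB]; rewrite (negPf (ncAB _ _ cA xB)) in cx.
split; first by rewrite inE dA.
move/forall_inP/(_ c cA)/forall_inP/(_ d dA): conA.
by apply: connect_cross_sub; apply: subsetUl.
Qed.

Lemma component_setUr A B c : no_cross A B -> c \in B ->
  component (A :|: B) c = component B c.
Proof.
move=> ncAB cB; apply/setP => d; rewrite !in_component.
apply/andP/andP => [[_ /connectP[s]]|[dB cd]]; last first.
  by split; [rewrite inE dB orbT|apply: connect_cross_sub cd; apply: subsetUr].
elim: s c cB => [|x s IHs] c cB /=; first by move=> _ ->; rewrite cB.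
move=> /andP[/and3P[_ xU cx] ps] dE.
have xB : x \in B.
  move: xU; rewrite inE => /orP[xA|//].
  by rewrite crossC (negPf (ncAB _ _ xA cB)) in cx.
have [dB xd] := IHs x xB ps dE; split=> //; apply: connect_trans (connect1 _) xd.
by rewrite /cross_in /= cB xB.
Qed.

(** This unfolds one level of the intersection order when the component of the smallest chord is
    known. *)
Lemma components_setU A B a :
  {in A :|: B &, injective fst} -> no_cross A B -> connected A -> a \in A ->
  [disjoint A & B] -> (forall d, d \in A :|: B -> a.1 <= d.1) ->
  components (A :|: B) = A :: components B.
Proof.
move=> inj nc conA aA disj amin.
have injB : {in B &, injective fst}.
  by move=> x y xB yB; apply: inj; rewrite inE ?xB ?yB orbT.
rewrite /components !filter_ccw_enum //.
set M := [set c in _ | _]; set M' := [set c in B | _].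
have M'B c : c \in M' -> c \in B by rewrite inE => /andP[].
(* Among the chords of A only [a] is smallest in its component, and a chord of B has the same
   component in B as in the union. *)
have ME : M = a |: M'.
  apply/setP => c; rewrite !inE; case cA: (c \in A) => /=.
    have cB : c \in B = false by apply: (disjointFr disj).
    rewrite component_setUl // cB orbF.
    have aU : a \in A :|: B by rewrite inE aA.
    have cU : c \in A :|: B by rewrite inE cA.
    apply/forall_inP/eqP => [/(_ a aA) le|-> d dA]; last by rewrite amin // inE dA.
    by apply: inj => //; apply/val_inj/eqP; rewrite eqn_leq le amin.
  have [ca|_] /= := eqVneq c a; first by rewrite ca aA in cA.
  by case cB: (c \in B) => //=; rewrite component_setUr.
have aM' : a \notin M' by apply/negP => /M'B; rewrite (disjointFr disj).
have injM : {in M &, injective fst}.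
  by move=> x y; rewrite !inE => /andP[xU _] /andP[yU _]; apply: inj; rewrite inE.
rewrite (ccw_enum_cons injM (c := a)) ?ME ?setU11 //; last first.
  by move=> d; rewrite -ME inE => /andP[dU _]; apply: amin.
rewrite setU1K //= component_setUl //; congr (_ :: _).
by apply/eq_in_map => x; rewrite mem_ccw_enum => /M'B xB; rewrite component_setUr.
Qed.

End ChordSets.

(** * Invariance under strictly increasing relabelling of points *)

Section Embedding.
Variables (a b : nat) (e : 'I_a.*2 -> 'I_b.*2).
Hypothesis ltn_e : forall i j, (e i < e j) = (i < j).
Implicit Types (c d : chord a) (S : {set chord a}).

Definition map_chord c : chord b := (e c.1, e c.2).

Lemma leq_e i j : (e i <= e j) = (i <= j).
Proof. by rewrite leqNgt ltn_e -leqNgt. Qed.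

Lemma e_inj : injective e.
Proof. by move=> i j eij; apply/val_inj/eqP; rewrite eqn_leq -!leq_e eij leqnn. Qed.

Lemma map_chord_inj : injective map_chord.
Proof. by move=> [i j] [k l] [/e_inj-> /e_inj->]. Qed.

Lemma mem_map_chord S c : (map_chord c \in map_chord @: S) = (c \in S).
Proof. exact: mem_imset map_chord_inj. Qed.

Lemma cross_map c d : cross (map_chord c) (map_chord d) = cross c d.
Proof. by rewrite /cross /= !ltn_e. Qed.

Lemma connect_map S c d :
  connect (cross_in (map_chord @: S)) (map_chord c) (map_chord d) =
  connect (cross_in S) c d.
Proof.
apply/connectP/connectP => [[s]|[s ps dE]]; last first.
  exists [seq map_chord x | x <- s]; last by rewrite last_map dE.
  rewrite path_map; apply: sub_path ps => x y /and3P[xS yS xy].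
  by rewrite /cross_in /= !mem_map_chord cross_map xS yS.
elim: s c => [|x s IHs] c /=; first by move=> _ /map_chord_inj ->; exists [::].
move=> /andP[/and3P[]]; rewrite mem_map_chord => cS /imsetP[y yS ->].
rewrite cross_map => cy ps dE; have [s' ps' dE'] := IHs y ps dE.
by exists (y :: s') => //; apply/andP; split=> //; apply/and3P.
Qed.

Lemma connected_map S : connected (map_chord @: S) = connected S.
Proof.
apply/forall_inP/forall_inP => conS c.
  move=> cS; apply/forall_inP => d dS; rewrite -connect_map.
  by have /forall_inP := conS _ (imset_f _ cS); apply; apply: imset_f.
move=> /imsetP[{}c cS ->]; apply/forall_inP => _ /imsetP[d dS ->].
by rewrite connect_map; have /forall_inP := conS _ cS; apply.
Qed.

Lemma component_map S c :
  component (map_chord @: S) (map_chord c) = map_chord @: component S c.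
Proof.
apply/setP => d; rewrite in_component.
apply/andP/imsetP => [[/imsetP[x xS ->]]|[x]].
  by rewrite connect_map => cx; exists x; rewrite // in_component xS.
by rewrite in_component => /andP[xS cx] ->; rewrite connect_map imset_f.
Qed.

Lemma map_chord_fst_inj S :
  {in S &, injective fst} -> {in map_chord @: S &, injective fst}.
Proof.
by move=> injS _ _ /imsetP[c cS ->] /imsetP[d dS ->] /e_inj /injS ->.
Qed.

Lemma ccw_enum_map S : {in S &, injective fst} ->
  ccw_enum (map_chord @: S) = [seq map_chord c | c <- ccw_enum S].
Proof.
move=> injS; apply: ccw_enum_unique; first exact: map_chord_fst_inj.
  rewrite sorted_map; apply: sub_sorted (ccw_enum_sorted injS) => c d /=.
  by rewrite ltn_e.
move=> c; apply/mapP/imsetP => -[d dS ->]; exists d => //; move: dS.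
  by rewrite mem_ccw_enum.
by rewrite mem_ccw_enum.
Qed.

Lemma components_map S : {in S &, injective fst} ->
  components (map_chord @: S) =
  [seq map_chord @: (T : {set chord a}) | T <- components S].
Proof.
move=> injS; rewrite /components ccw_enum_map // filter_map -!map_comp.
under eq_map do rewrite /= component_map.
congr map; apply: eq_filter => c /=; rewrite component_map.
apply/forall_inP/forall_inP => minc d; last first.
  by move=> /imsetP[{}d dS ->]; rewrite leq_e minc.
by move=> dS; have := minc _ (imset_f _ dS); rewrite leq_e.
Qed.

Lemma intersection_rec_map k S : {in S &, injective fst} ->
  intersection_rec k (map_chord @: S) =
  [seq map_chord c | c <- intersection_rec k S].
Proof.
elim: k S => [//|k IHk] S injS /=; rewrite ccw_enum_map //.
case: (ccw_enum S) => [//|r s] /=; congr (_ :: _).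
have -> : map_chord @: S :\ map_chord r = map_chord @: (S :\ r).
  apply/setP => d; rewrite !inE; apply/andP/imsetP => [[ndr /imsetP[x xS dE]]|[x]].
    by exists x; rewrite // !inE xS andbT; apply: contraNneq ndr => <-; rewrite dE.
  by rewrite !inE => /andP[nxr xS] ->; rewrite imset_f // (inj_eq map_chord_inj).
have injS' : {in S :\ r &, injective fst}.
  by move=> x y; rewrite !inE => /andP[_ xS] /andP[_ yS]; apply: injS.
rewrite components_map // map_flatten -!map_comp; congr flatten.
apply/eq_in_map => c _ /=; apply: IHk => x y.
by move=> /(subsetP (component_sub _ _)) xS /(subsetP (component_sub _ _)); apply: injS'.
Qed.

Lemma terminal_map S c :
  terminal (map_chord @: S) (map_chord c) = terminal S c.
Proof.
congr (~~ _); apply/exists_inP/exists_inP => [[_ /imsetP[d dS ->]]|[d dS cd]].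
  by rewrite cross_map ltn_e => cd; exists d.
by exists (map_chord d); rewrite ?imset_f // cross_map ltn_e.
Qed.

End Embedding.

(** Inside an insertion, the recursion reaches D and C with more fuel than their own orders use; the
    surplus is harmless. *)
Lemma eq_intersection_rec n (S : {set chord n}) k l :
  #|S| <= k -> #|S| <= l -> intersection_rec k S = intersection_rec l S.
Proof.
elim: k l S => [|k IHk] l S.
  rewrite leqn0 cards_eq0 => /eqP-> _; case: l => //= l.
  by case E: (ccw_enum _) => [//|r s]; have := mem_ccw_enum set0 r; rewrite E mem_head inE.
case: l => [|l] leSk leSl.
  move: leSl; rewrite leqn0 cards_eq0 => /eqP-> /=.
  by case E: (ccw_enum _) => [//|r s]; have := mem_ccw_enum set0 r; rewrite E mem_head inE.
rewrite /=; case E: (ccw_enum _) => [//|r s].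
have rS : r \in S by rewrite -mem_ccw_enum E mem_head.
move: leSk leSl; rewrite (cardsD1 r S) rS !ltnS => leSk leSl.
congr (_ :: flatten _); apply/eq_in_map => T /mapP[c _ ->].
have le := subset_leq_card (component_sub (S :\ r) c).
by apply: IHk; apply: leq_trans le _.
Qed.

(** * Insertion of a diagram into a gap *)

Lemma chord_diagram_lt n (C : {set chord n}) c : chord_diagram C -> c \in C -> c.1 < c.2.
Proof. by case/andP => /forall_inP lt _; apply: lt. Qed.

Lemma chord_diagram_cover n (C : {set chord n}) (x : 'I_n.*2) :
  chord_diagram C -> exists2 c, c \in C & (x == c.1) || (x == c.2).
Proof.
case/andP => _ /forallP/(_ x)/cards1P[c cE]; have := set11 c.
by rewrite -cE inE => /andP[cC xc]; exists c.
Qed.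

Lemma chord_diagram_owner n (C : {set chord n}) (x : 'I_n.*2) c d :
  chord_diagram C -> c \in C -> d \in C ->
  (x == c.1) || (x == c.2) -> (x == d.1) || (x == d.2) -> c = d.
Proof.
case/andP => _ /forallP/(_ x)/cards1P[e eE] cC dC xc xd.
have : c \in [set e] by rewrite -eE inE cC.
have : d \in [set e] by rewrite -eE inE dC.
by rewrite !inE => /eqP-> /eqP->.
Qed.

(* The insertion of C into the q-th gap of D, where the root of C goes to the *)
(* front: with i.+1 chords in D and (n - i).+1 in C, the points of C become   *)
(* 0 and q.+2, ..., q.+1 + (n - i).*2.+1, and those of D become the others.   *)
Section Insertion.
Variables (n : nat) (i : 'I_n.+1) (q : 'I_i.*2.+1).
Implicit Types (D : {set chord i.+1}) (C : {set chord (n - i).+1}).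

Lemma outer_subproof (x : 'I_i.+1.*2) :
  (if x <= q then x.+1 else x + (n - i).+1.*2) < n.+2.*2.
Proof. by have := ltn_ord x; have := ltn_ord i; have := ltn_ord q; case: ifP; lia. Qed.

Definition outer x := Ordinal (outer_subproof x).

Lemma inner_subproof (x : 'I_(n - i).+1.*2) :
  (if x == 0 :> nat then 0 else x + q.+1) < n.+2.*2.
Proof. by have := ltn_ord x; have := ltn_ord i; have := ltn_ord q; case: ifP; lia. Qed.

Definition inner x := Ordinal (inner_subproof x).

Lemma ltn_outer x y : (outer x < outer y) = (x < y).
Proof. by rewrite /=; case: ifP; case: ifP; lia. Qed.

Lemma ltn_inner x y : (inner x < inner y) = (x < y).
Proof. by rewrite /=; case: ifP; case: ifP; lia. Qed.

Lemma outer_inner x y : (outer x == inner y) = false.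
Proof.
apply/negP => /eqP/(congr1 val) /=.
by have := ltn_ord y; case: ifP; case: ifP; lia.
Qed.

Lemma outerP (v : 'I_n.+2.*2) :
  reflect (exists x, v = outer x)
    ((0 < v <= q.+1) || (q.+1 + (n - i).+1.*2 <= v)).
Proof.
apply: (iffP idP) => [|[x ->] /=]; last first.
  by have := ltn_ord x; case: ifP; lia.
have iq := ltn_ord q; have li := ltn_ord i; have lv := ltn_ord v.
case: (leqP v q.+1) => [le_vq|lt_qv]; rewrite ?andbT ?andbF /= => v_out.
  have lt : v.-1 < i.+1.*2 by lia.
  by exists (Ordinal lt); apply/val_inj => /=; case: ifP; lia.
have lt : v - (n - i).+1.*2 < i.+1.*2 by lia.
by exists (Ordinal lt); apply/val_inj => /=; case: ifP; lia.
Qed.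

Lemma innerP (v : 'I_n.+2.*2) :
  reflect (exists x, v = inner x) ((v == 0 :> nat) || (q.+1 < v < q.+1 + (n - i).+1.*2)).
Proof.
apply: (iffP idP) => [|[x ->] /=]; last first.
  by have := ltn_ord x; case: ifP; lia.
have iq := ltn_ord q; have li := ltn_ord i; have lv := ltn_ord v.
case: eqP => [v0 _|v_neq0 /= v_in].
  have lt : 0 < (n - i).+1.*2 by lia.
  by exists (Ordinal lt); apply/val_inj => /=.
have lt : v - q.+1 < (n - i).+1.*2 by lia.
by exists (Ordinal lt); apply/val_inj => /=; case: ifP; lia.
Qed.

Lemma outer_or_inner v : (exists x, v = outer x) \/ (exists y, v = inner y).
Proof.
case: (boolP ((v == 0 :> nat) || (q.+1 < v < q.+1 + (n - i).+1.*2))) => [/innerP|nin].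
  by right.
by left; apply/outerP; move: nin; lia.
Qed.

Lemma map_outer_inner c d : map_chord outer c <> map_chord inner d.
Proof. by move=> /(congr1 fst)/eqP; rewrite outer_inner. Qed.

Definition insert D C : {set chord n.+2} :=
  map_chord outer @: D :|: map_chord inner @: C.

Lemma outer_in_insert D C c : (map_chord outer c \in insert D C) = (c \in D).
Proof.
rewrite inE (mem_map_chord ltn_outer); case: (c \in D) => //=.
by apply/imsetP => -[d _ /map_outer_inner].
Qed.

Lemma inner_in_insert D C c : (map_chord inner c \in insert D C) = (c \in C).
Proof.
rewrite inE (mem_map_chord ltn_inner) orbC; case: (c \in C) => //=.
by apply/imsetP => -[d _ /esym/map_outer_inner].
Qed.

Lemma insert_disjoint D C :
  [disjoint map_chord outer @: D & map_chord inner @: C].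
Proof.
apply/pred0P => c /=; apply/andP => -[/imsetP[d _ ->] /imsetP[e _]].
exact: map_outer_inner.
Qed.

Lemma chord_diagram_insert D C :
  chord_diagram (insert D C) = chord_diagram D && chord_diagram C.
Proof.
have outerE x : [set c in insert D C | (outer x == c.1) || (outer x == c.2)]
    = map_chord outer @: [set c in D | (x == c.1) || (x == c.2)].
  apply/setP => c; rewrite inE; apply/andP/imsetP => [[]|[d]].
    case/setUP => /imsetP[d dD ->] /=; last by rewrite !outer_inner.
    rewrite !(inj_eq (e_inj ltn_outer)) => xd; exists d => //.
    by rewrite inE dD.
  rewrite inE => /andP[dD xd] ->; rewrite outer_in_insert dD /=.
  by rewrite !(inj_eq (e_inj ltn_outer)).
have innerE x : [set c in insert D C | (inner x == c.1) || (inner x == c.2)]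
    = map_chord inner @: [set c in C | (x == c.1) || (x == c.2)].
  apply/setP => c; rewrite inE; apply/andP/imsetP => [[]|[d]].
    case/setUP => /imsetP[d dD ->] /=; first by rewrite !(eq_sym (inner x)) !outer_inner.
    rewrite !(inj_eq (e_inj ltn_inner)) => xd; exists d => //.
    by rewrite inE dD.
  rewrite inE => /andP[dD xd] ->; rewrite inner_in_insert dD /=.
  by rewrite !(inj_eq (e_inj ltn_inner)).
have cardE m (e : 'I_m.*2 -> 'I_n.+2.*2) (ltn_e : forall x y, (e x < e y) = (x < y))
    (S : {set chord m}) :
    #|map_chord e @: S| = #|S| by apply: card_imset; apply: map_chord_inj.
apply/andP/andP => [[/forall_inP lt /forallP card1]|].
  have ltD c : c \in D -> c.1 < c.2.
    by move=> cD; rewrite -ltn_outer (lt (map_chord outer c)) // outer_in_insert.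
  have ltC c : c \in C -> c.1 < c.2.
    by move=> cC; rewrite -ltn_inner (lt (map_chord inner c)) // inner_in_insert.
  split; apply/andP; split; try exact/forall_inP.
    by apply/forallP => x; rewrite -(cardE _ _ ltn_outer) -outerE.
  by apply/forallP => x; rewrite -(cardE _ _ ltn_inner) -innerE.
case=> /andP[/forall_inP ltD /forallP cardD] /andP[/forall_inP ltC /forallP cardC].
split.
  apply/forall_inP => c /setUP[] /imsetP[x xS ->].
    by rewrite [_ < _]ltn_outer ltD.
  by rewrite [_ < _]ltn_inner ltC.
apply/forallP => v; case: (outer_or_inner v) => -[x ->].
  by rewrite outerE (cardE _ _ ltn_outer).
by rewrite innerE (cardE _ _ ltn_inner).
Qed.

End Insertion.

Lemma connected_setU n (A B : {set chord n}) a b :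
  connected A -> connected B -> a \in A -> b \in B -> cross a b ->
  connected (A :|: B).
Proof.
move=> /forall_inP conA /forall_inP conB aA bB ab.
have ab' : connect (cross_in (A :|: B)) a b.
  by apply: connect1; rewrite /cross_in /= !inE aA bB orbT.
have to_a c : c \in A :|: B -> connect (cross_in (A :|: B)) c a.
  case/setUP => [cA|cB].
    have /forall_inP/(_ a aA) := conA c cA.
    by apply: connect_cross_sub; apply: subsetUl.
  apply: (@connect_trans _ _ b); last by rewrite cross_in_sym.
  have /forall_inP/(_ b bB) := conB c cB.
  by apply: connect_cross_sub; apply: subsetUr.
apply/forall_inP => c cU; apply/forall_inP => d dU.
by apply: connect_trans (to_a c cU) _; rewrite cross_in_sym to_a.
Qed.

Lemma connected_cross n (C : {set chord n}) c d :
  connected C -> c \in C -> d \in C -> c != d -> exists2 e, e \in C & cross c e.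
Proof.
move=> /forall_inP conC cC dC.
have /forall_inP/(_ d dC)/connectP[[|e s] /=] := conC c cC.
  by move=> _ ->; rewrite eqxx.
by move=> /andP[/and3P[_ eC ce] _] _ _; exists e.
Qed.

Lemma root_chord n (C : {set chord n.+1}) :
  chord_diagram C -> exists2 r, r \in C & r.1 = 0 :> nat.
Proof.
move=> dC; have [r rC /orP[]/eqP r0] := @chord_diagram_cover _ C (@ord0 n.*2.+1) dC.
  by exists r; rewrite // -r0.
by have := chord_diagram_lt dC rC; rewrite -r0.
Qed.

Lemma root_chord_unique n (C : {set chord n}) r c :
  chord_diagram C -> r \in C -> r.1 = 0 :> nat -> c \in C :\ r -> 0 < c.1.
Proof.
move=> dC rC r0; rewrite !inE => /andP[ncr cC]; rewrite lt0n.
apply: contra ncr => /eqP c0; apply/eqP/(chord_diagram_fst_inj dC) => //.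
by apply: val_inj; rewrite /= c0 r0.
Qed.

Lemma terminal_root n (C : {set chord n}) r :
  rccd C -> r \in C -> r.1 = 0 :> nat -> terminal C r = (n == 1).
Proof.
move=> /and3P[n0 dC conC] rC r0; have cardC := card_chord_diagram dC.
rewrite /terminal; case: eqP => n1.
  have /cards1P[x xE] : #|C| == 1 by rewrite cardC n1.
  apply/exists_inP => -[c cC]; move: rC cC; rewrite xE !inE => /eqP-> /eqP->.
  by rewrite ltnn.
apply/negbTE; rewrite negbK.
have /card_gt0P[c cCr] : 0 < #|C :\ r|.
  by move: cardC; rewrite (cardsD1 r) rC; lia.
have : c \in C :\ r by []; rewrite !inE => /andP[ncr cC].
have [e eC re] : exists2 e, e \in C & cross r e.
  by apply: (connected_cross conC rC cC); rewrite eq_sym.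
apply/exists_inP; exists e; rewrite // re andbT r0.
rewrite (root_chord_unique dC rC r0) // !inE eC andbT.
by apply: contraTneq re => ->; rewrite /cross; lia.
Qed.

Lemma intersection_order_root n (S : {set chord n}) x :
  chord_diagram S -> x \in S -> x.1 = 0 :> nat ->
  intersection_order S =
  x :: flatten [seq intersection_rec #|S :\ x| T | T <- components (S :\ x)].
Proof.
move=> dS xS x0; rewrite /intersection_order (cardsD1 x S) xS /=.
by rewrite (ccw_enum_cons (chord_diagram_fst_inj dS) xS) // x0.
Qed.

(** * Connectedness, intersection order and terminal chords of an insertion *)

Section InsertionOrder.
Variables (n : nat) (i : 'I_n.+1) (q : 'I_i.*2.+1).
Variables (D : {set chord i.+1}) (C : {set chord (n - i).+1}).
Hypotheses (rcD : rccd D) (rcC : rccd C).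
Local Notation outc := (map_chord (outer q)).
Local Notation innc := (map_chord (inner q)).

Let dD : chord_diagram D. Proof. by case/and3P: rcD. Qed.
Let dC : chord_diagram C. Proof. by case/and3P: rcC. Qed.
Let conD : connected D. Proof. by case/and3P: rcD. Qed.
Let conC : connected C. Proof. by case/and3P: rcC. Qed.

Variable r : chord (n - i).+1.
Hypotheses (rC : r \in C) (r0 : r.1 = 0 :> nat).

(** As D is connected, some chord of it joins a point before the gap to a point after it. The moved
    root runs from the front into the gap, so it crosses that chord. *)
Lemma outer_cross_root : exists2 c, c \in D & cross (outc c) (innc r).
Proof.
have [c cD c_last] := @chord_diagram_cover _ D (@ord_max i.*2.+1) dD.
have [d dD' d_first] := @chord_diagram_cover _ D (@ord0 i.*2.+1) dD.
have ltD e : e \in D -> e.1 < e.2 by apply: chord_diagram_lt.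
have lt_q := ltn_ord q; have lt_i := ltn_ord i.
have max_val : val (@ord_max i.*2.+1) = i.*2.+1 by [].
have min_val : val (@ord0 i.*2.+1) = 0 by [].
have [||||e eD e_str] := @connected_straddle _ D q i.+1.*2 c d ltD conD => //.
- have in_last : q < i.*2.+1 < i.+1.*2 by rewrite doubleS leqnn andbT; exact: lt_q.
  by case/orP: c_last => /eqP <-; rewrite max_val in_last ?orbT.
- by case/orP: d_first => /eqP <-; rewrite min_val ltn0 ?andbF.
have [le_q lt_q2] : e.1 <= q /\ q < e.2.
  move: e_str (ltD _ eD); rewrite !ltn_ord !andbT.
  by move: (val e.1) (val e.2) (val q) => x y z; clear; lia.
have := ltn_ord r.2; have := chord_diagram_lt dC rC; rewrite r0 => r2 r2m.
exists e; rewrite // /cross /= r0 /= le_q (leqNgt e.2) lt_q2 /= eqn0Ngt r2 /=.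
suff aux x y z u t : x <= z -> z < y -> 0 < u -> u < t -> x.+1 < u + z.+1 < y + t by apply: aux.
by clear; lia.
Qed.

Lemma connected_insert : connected (insert q D C).
Proof.
have [c cD cr] := outer_cross_root.
apply: (@connected_setU _ _ _ (outc c) (innc r)) => //.
- by rewrite connected_map //; apply: ltn_outer.
- by rewrite connected_map //; apply: ltn_inner.
- by rewrite imset_f.
- by rewrite imset_f.
Qed.

Lemma rccd_insert : rccd (insert q D C).
Proof. by rewrite /rccd chord_diagram_insert dD dC connected_insert. Qed.

Lemma insert_root :
  insert q D C :\ innc r = outc @: D :|: innc @: (C :\ r).
Proof.
apply/setP => c; rewrite !inE; apply/andP/orP => [[ncr /orP[cD|]]|[]].
- by left.
- move=> /imsetP[d dCr cE]; right; rewrite cE imset_f // !inE dCr andbT.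
  by apply: contraNneq ncr => <-; rewrite cE.
- move=> cD; rewrite cD; split=> //; case/imsetP: cD => d _ ->.
  by apply/eqP/map_outer_inner.
- case/imsetP => d; rewrite !inE => /andP[ndr dC'] ->.
  by rewrite (inj_eq (map_chord_inj (@ltn_inner _ _ q))) ndr imset_f ?orbT.
Qed.

(** Apart from the root, C occupies a block of consecutive points containing no endpoint of D. *)
Lemma no_cross_outer_inner : no_cross (outc @: D) (innc @: (C :\ r)).
Proof.
move=> _ _ /imsetP[c cD ->] /imsetP[d dCr ->].
have out_range x : (outer q x <= q.+1) || (q.+1 + (n - i).+1.*2 <= outer q x).
  have /outerP : exists y, outer q x = outer q y by exists x.
  by case/orP => [/andP[_ ->]|->]; rewrite ?orbT.
have in_range (x : 'I_(n - i).+1.*2) : 0 < x -> q.+1 < inner q x < q.+1 + (n - i).+1.*2.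
  move=> x0 /=; rewrite eqn0Ngt x0 /= addnC -[X in X < _]addn0 !ltn_add2l x0.
  exact: ltn_ord.
have d1 := root_chord_unique dC rC r0 dCr.
have d2 : 0 < d.2.
  by case/setD1P: dCr => _ /(chord_diagram_lt dC); apply: leq_trans.
have := in_range _ d1; have := in_range _ d2.
have := out_range c.1; have := out_range c.2.
rewrite /cross; move: (q.+1) (q.+1 + _) => l h.
suff aux c1 c2 d1' d2' : (c2 <= l) || (h <= c2) -> (c1 <= l) || (h <= c1) ->
    l < d2' < h -> l < d1' < h ->
    ~~ ([&& c1 < d1', d1' < c2 & c2 < d2'] || [&& d1' < c1, c1 < d2' & d2' < c2]).
  exact: aux.
by clear; lia.
Qed.

(** Once the root is deleted, D is the component starting at the second point, and the other
    components are those of C without its root; [behead] drops that root, which now stands in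
    front. *)
Lemma intersection_order_insert :
  intersection_order (insert q D C) =
  innc r :: [seq outc c | c <- intersection_order D] ++
             behead [seq innc c | c <- intersection_order C].
Proof.
have dI : chord_diagram (insert q D C) by rewrite chord_diagram_insert dD.
have injI := chord_diagram_fst_inj dI.
have injI' : {in outc @: D :|: innc @: (C :\ r) &, injective fst}.
  by rewrite -insert_root => x y /setD1P[_ xI] /setD1P[_ yI]; apply: injI.
rewrite (intersection_order_root dI (x := innc r)); last by rewrite /= r0.
  congr (_ :: _); rewrite insert_root.
  have [a aD a0] := root_chord dD.
  rewrite (@components_setU _ _ _ (outc a)) //; first last.
  - case=> d1 d2 /setUP[] /imsetP[d dS [-> _]] /=.
      by rewrite [_ <= _](leq_e (@ltn_outer _ _ q)) a0.
    have := root_chord_unique dC rC r0 dS; rewrite lt0n => /negPf d0.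
    by rewrite a0 /= d0 addnS.
  - by apply: disjointWr (insert_disjoint q D C); apply/imsetS/subsetDl.
  - by rewrite imset_f.
  - by rewrite connected_map //; apply: ltn_outer.
  - exact: no_cross_outer_inner.
  rewrite /= (intersection_order_root dC rC r0) /=.
  set k := #|_|; have inj_outer := map_chord_inj (@ltn_outer _ _ q).
  have inj_inner := map_chord_inj (@ltn_inner _ _ q).
  have injC : {in C :\ r &, injective fst}.
    move=> x y /setD1P[_ xC] /setD1P[_ yC].
    exact: (chord_diagram_fst_inj dC).
  congr (_ ++ _).
    rewrite (intersection_rec_map (@ltn_outer _ _ q)) //; last first.
      exact: chord_diagram_fst_inj.
    congr map; apply: eq_intersection_rec => //.
    by rewrite -(card_imset _ inj_outer) subset_leq_card // subsetUl.
  rewrite (components_map (@ltn_inner _ _ q)) // map_flatten -!map_comp.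
  congr flatten; apply/eq_in_map => c _ /=.
  have sub : component (C :\ r) c \subset C :\ r by apply: component_sub.
  rewrite (intersection_rec_map (@ltn_inner _ _ q)); last first.
    by move=> x y /(subsetP sub) xC /(subsetP sub); apply: injC.
  congr map; apply: eq_intersection_rec; last exact: subset_leq_card.
  apply: leq_trans (subset_leq_card sub) _.
  by rewrite -(card_imset _ inj_inner) subset_leq_card // subsetUr.
by rewrite inE imset_f ?orbT.
Qed.

Lemma terminal_insert_root : terminal (insert q D C) (innc r) = false.
Proof. by rewrite (terminal_root rccd_insert) //= ?inner_in_insert // r0. Qed.

(** The only inner chord that an outer chord can cross is the root, which is smaller and so does not
    affect terminality. *)
Lemma terminal_insert_outer c : c \in D ->
  terminal (insert q D C) (outc c) = terminal D c.
Proof.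
move=> cD; rewrite -(terminal_map (@ltn_outer _ _ q)); congr (~~ _).
apply/exists_inP/exists_inP => -[d]; last by exists d; rewrite // inE; apply/orP; left.
move=> dI /andP[lt cr]; exists d; last by rewrite lt.
case/setUP: dI => // /imsetP[e eC dE]; move: lt cr; rewrite dE.
have [->|ner] := eqVneq e r; first by rewrite /= r0 ltn0.
by move=> _; apply/contraTT => _; apply: no_cross_outer_inner; rewrite imset_f // !inE ner.
Qed.

Lemma terminal_insert_inner c : c \in C :\ r ->
  terminal (insert q D C) (innc c) = terminal C c.
Proof.
move=> cCr; rewrite -(terminal_map (@ltn_inner _ _ q)); congr (~~ _).
apply/exists_inP/exists_inP => -[d]; last by exists d; rewrite // inE; apply/orP; right.
move=> dI /andP[lt cr]; exists d; last by rewrite lt.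
case/setUP: dI => // dD'; rewrite crossC in cr.
by rewrite (negPf (no_cross_outer_inner _ _)) ?imset_f in cr.
Qed.

Lemma terminal_flags_insert :
  map (terminal (insert q D C)) (intersection_order (insert q D C)) =
  false :: map (terminal D) (intersection_order D) ++
           behead (map (terminal C) (intersection_order C)).
Proof.
rewrite intersection_order_insert /= terminal_insert_root map_cat; congr (_ :: _ ++ _).
  rewrite -map_comp; apply/eq_in_map => c; rewrite intersection_order_mem.
  exact: terminal_insert_outer.
have := intersection_rec_uniq (chord_diagram_fst_inj dC) (leqnn #|C|).
have := @intersection_order_mem _ C; rewrite /intersection_order.
rewrite -/(intersection_order C) (intersection_order_root dC rC r0) /=.
set s := flatten _ => memC /andP[rs _].
rewrite -map_comp; apply/eq_in_map => c cs; apply: terminal_insert_inner.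
rewrite !inE -memC inE cs orbT andbT.
by apply: contraNneq rs => <-.
Qed.

End InsertionOrder.

(** * Diagrams with at least two chords are insertions in a unique way *)

Lemma card_ord_interval k l h : h <= k -> #|[set v : 'I_k | l <= v < h]| = h - l.
Proof.
move=> hk; rewrite cardsE -sum1_card -(big_mkord (fun v => l <= v < h) (fun=> 1)).
rewrite -[RHS]muln1 -sum_nat_const_nat (big_nat_widen _ _ _ _ _ hk).
by rewrite (big_nat_widenl _ _ _ _ _ (leq0n l)); apply: eq_bigl => v; rewrite andbC.
Qed.

(** Separation of two disjoint pairs of points on a circle is symmetric. *)
Lemma straddle_swap (x y l h : nat) :
  x < y -> l < h -> x != l -> x != h -> y != l -> y != h ->
  (x < l < y) != (x < h < y) -> (l < x < h) = ~~ (l < y < h).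
Proof. lia. Qed.

Lemma straddle_cross (x y l h : nat) :
  x < y -> l < h -> x != l -> x != h -> y != l -> y != h ->
  (l < x < h) != (l < y < h) ->
  [&& x < l, l < y & y < h] || [&& l < x, x < h & h < y].
Proof. lia. Qed.

(** * Interleaving connected sets of chords must cross *)

Section Endpoints.
Variables (n : nat) (C : {set chord n}).
Hypothesis dC : chord_diagram C.
Implicit Types (A B : {set chord n}) (x y v : 'I_n.*2).

Definition endpoints A : {set 'I_n.*2} := (fst @: A) :|: (snd @: A).

Lemma endpointsP A v :
  reflect (exists2 c, c \in A & (v == c.1) || (v == c.2)) (v \in endpoints A).
Proof.
rewrite inE; apply: (iffP orP) => [[]/imsetP[c cA ->]|[c cA /orP[]/eqP->]].
- by exists c; rewrite ?eqxx.
- by exists c; rewrite ?eqxx ?orbT.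
- by left; apply: imset_f.
- by right; apply: imset_f.
Qed.

Lemma endpoints_owner A v c : A \subset C -> c \in C ->
  (v == c.1) || (v == c.2) -> (v \in endpoints A) = (c \in A).
Proof.
move=> /subsetP sAC cC vc; apply/endpointsP/idP => [[d dA vd]|cA]; last by exists c.
by rewrite (chord_diagram_owner dC cC (sAC _ dA) vc vd).
Qed.

Lemma card_endpoints A : A \subset C -> #|endpoints A| = #|A|.*2.
Proof.
move=> /subsetP sAC; rewrite cardsU.
have -> : fst @: A :&: snd @: A = set0.
  apply/setP => v; rewrite !inE; apply/andP => -[/imsetP[c cA ->] /imsetP[d dA cd]].
  have cE : c = d.
    by apply: (@chord_diagram_owner _ _ c.1 _ _ dC); rewrite ?sAC // ?eqxx // cd eqxx orbT.
  by have := chord_diagram_lt dC (sAC _ cA); rewrite cd cE ltnn.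
rewrite cards0 subn0 !card_in_imset ?addnn // => c d cA dA; last first.
  exact: (chord_diagram_fst_inj dC (sAC _ cA) (sAC _ dA)).
by move=> cd; apply: (@chord_diagram_owner _ _ c.2 _ _ dC); rewrite ?sAC ?eqxx ?orbT // cd eqxx orbT.
Qed.

(** A discrete Jordan curve argument: some chord e of B separates x1 from x2, and then, A being
    connected, some chord of A separates the ends of e. *)
Lemma interleave_cross A B x1 y1 x2 y2 :
  A \subset C -> B \subset C -> [disjoint A & B] -> connected A -> connected B ->
  x1 \in endpoints A -> y1 \in endpoints B ->
  x2 \in endpoints A -> y2 \in endpoints B ->
  x1 < y1 -> y1 < x2 -> x2 < y2 -> exists2 c, c \in A & exists2 d, d \in B & cross c d.
Proof.
move=> sAC sBC disj conA conB /endpointsP[a1 a1A x1a] /endpointsP[b1 b1B y1b].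
move=> /endpointsP[a2 a2A x2a] /endpointsP[b2 b2B y2b] x1y1 y1x2 x2y2.
have ltA c : c \in A -> c.1 < c.2 by move=> cA; apply: chord_diagram_lt dC _; apply: (subsetP sAC).
have ltB c : c \in B -> c.1 < c.2 by move=> cB; apply: chord_diagram_lt dC _; apply: (subsetP sBC).
have neq v c d : c \in A -> d \in B -> (v == c.1) || (v == c.2) ->
    ((v == d.1) || (v == d.2)) = false.
  move=> cA dB vc; apply/negP => vd; move: (disjointFr disj cA).
  have -> : c = d.
    apply: (chord_diagram_owner dC _ _ vc vd); first exact: (subsetP sAC).
    exact: (subsetP sBC).
  by rewrite dB.
have [||||e eB e_str] := @connected_straddle _ B x1 x2 b1 b2 ltB conB => //.
- by case/orP: y1b => /eqP <-; rewrite x1y1 y1x2 ?orbT.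
- by case/orP: y2b => /eqP <-; rewrite (ltnNge y2) (ltnW x2y2) ?andbF.
have neqv v w c d : c \in A -> d \in B -> (v == c.1) || (v == c.2) ->
    (w == d.1) || (w == d.2) -> v != w :> nat.
  move=> cA dB vc wd; apply: contraTneq wd => /val_inj <-.
  by rewrite (neq v c d).
have e1e : (e.1 == e.1) || (e.1 == e.2) by rewrite eqxx.
have e2e : (e.2 == e.1) || (e.2 == e.2) by rewrite eqxx orbT.
have swap : (e.1 < x1 < e.2) = ~~ (e.1 < x2 < e.2).
  apply: straddle_swap e_str;
    first [exact: ltn_trans y1x2|exact: ltB|exact: neqv a1A eB x1a e1e|exact: neqv a1A eB x1a e2e
          |exact: neqv a2A eB x2a e1e|exact: neqv a2A eB x2a e2e].
have [c cA c_str] : exists2 c, c \in A & (e.1 < c.1 < e.2) != (e.1 < c.2 < e.2).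
  have [in1|out1] := boolP (e.1 < x1 < e.2).
    apply: (connected_straddle ltA conA a1A a2A).
      by case/orP: x1a => /eqP <-; rewrite in1 ?orbT.
    have out2 : (e.1 < x2 < e.2) = false by apply/negbTE; rewrite -swap.
    by case/orP: x2a => /eqP <-; rewrite out2 ?andbF.
  apply: (connected_straddle ltA conA a2A a1A).
    have in2 : e.1 < x2 < e.2 by rewrite swap negbK in out1.
    by case/orP: x2a => /eqP <-; rewrite in2 ?orbT.
  by case/orP: x1a => /eqP <-; rewrite (negPf out1) ?andbF.
exists c => //; exists e => //.
have c1c : (c.1 == c.1) || (c.1 == c.2) by rewrite eqxx.
have c2c : (c.2 == c.1) || (c.2 == c.2) by rewrite eqxx orbT.
apply: straddle_cross c_str;
  first [exact: ltA|exact: ltB|exact: neqv cA eB c1c e1e|exact: neqv cA eB c1c e2e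
        |exact: neqv cA eB c2c e1e|exact: neqv cA eB c2c e2e].
Qed.

End Endpoints.

(** A component that did not cross [r] would already be a component of C, which is connected. *)
Lemma component_cross n (C : {set chord n}) r x :
  connected C -> r \in C -> x \in C :\ r ->
  exists2 y, y \in component (C :\ r) x & cross y r.
Proof.
move=> conC rC xCr; set B := component _ x.
have xB : x \in B by rewrite in_component xCr connect0.
have [/exists_inP[y yB yr]|none] := boolP [exists y in B, cross y r]; first by exists y.
have sBC : B \subset C by apply: subset_trans (component_sub _ _) (subsetDl _ _).
have nc : no_cross B (C :\: B).
  move=> c d cB; rewrite inE => /andP[dB dC].
  have [->|ndr] := eqVneq d r.
    by apply: contra none => cr; apply/exists_inP; exists c.
  apply: contra dB => cd; move: cB; rewrite !in_component => /andP[cCr xc].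
  rewrite !inE ndr dC; apply: connect_trans xc (connect1 _).
  by rewrite /cross_in /= cCr !inE ndr dC.
have := component_setUl nc (component_connected xCr) xB.
have -> : B :|: C :\: B = C by rewrite -{1}(setIidPr sBC) setID.
move=> compE.
have : r \in component C x.
  rewrite in_component rC; move/forall_inP: conC => /(_ x).
  by case/setD1P: xCr => _ xC /(_ xC)/forall_inP; apply.
by rewrite compE in_component !inE eqxx.
Qed.

(** * Splitting off the component of the second point *)

Section Decomposition.
Variables (n : nat) (C : {set chord n.+2}).
Hypothesis rcC : rccd C.

Let dC : chord_diagram C. Proof. by case/and3P: rcC. Qed.
Let conC : connected C. Proof. by case/and3P: rcC. Qed.

(** If the root ended at the second point, it would cross nothing, although there are at least two
    chords. *)
Lemma second_chord r : r \in C -> r.1 = 0 :> nat ->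
  exists2 a, a \in C :\ r & a.1 = 1 :> nat.
Proof.
move=> rC r0; pose one := @Ordinal n.+2.*2 1 isT.
have [a aC a1] := @chord_diagram_cover _ C one dC.
have nar : a != r.
  apply/eqP => ar; have /card_gt0P[x] : 0 < #|C :\ r|.
    by move: (card_chord_diagram dC); rewrite (cardsD1 r) rC add1n => -[->].
  case/setD1P=> nxr xC; rewrite eq_sym in nxr.
  have [e eC re] := connected_cross conC rC xC nxr.
  have r2 : r.2 = 1 :> nat.
    move: a1; rewrite ar => /orP[]/eqP r1; last by rewrite -r1.
    by move: r0; rewrite -r1.
  have ner : e != r by apply: contraTneq re => ->; rewrite /cross !ltnn !andbF.
  have := root_chord_unique dC rC r0 (c := e); rewrite !inE ner eC => /(_ isT) e0.
  by move: re; rewrite /cross r0 r2 ltn0 /= orbF e0 => /andP[]; rewrite ltnS leqNgt e0.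
exists a; first by rewrite !inE nar.
case/orP: a1 => /eqP a1; first by rewrite -a1.
have := root_chord_unique dC rC r0 (c := a); rewrite !inE nar aC => /(_ isT) a0.
by have := chord_diagram_lt dC aC; rewrite -a1 ltnS leqNgt a0.
Qed.

Variables r a : chord n.+2.
Hypotheses (rC : r \in C) (r0 : r.1 = 0 :> nat).
Hypotheses (aCr : a \in C :\ r) (a1 : a.1 = 1 :> nat).
Let A := component (C :\ r) a.

Let sAC : A \subset C.
Proof. exact: subset_trans (component_sub _ _) (subsetDl _ _). Qed.
Let aA : a \in A. Proof. by rewrite in_component aCr connect0. Qed.
Let conA : connected A. Proof. exact: component_connected. Qed.
Let rA : (r \in A) = false.
Proof. by rewrite in_component !inE eqxx. Qed.
Let r1_out : r.1 \notin endpoints A.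
Proof. by rewrite (endpoints_owner dC sAC rC) ?rA // eqxx. Qed.
Let r2_out : r.2 \notin endpoints A.
Proof. by rewrite (endpoints_owner dC sAC rC) ?rA // eqxx orbT. Qed.
Let a_in : a.1 \in endpoints A.
Proof. by rewrite inE imset_f. Qed.

Lemma cross_rootE y : y \in C :\ r -> cross y r -> 0 < y.1 /\ y.1 < r.2 < y.2.
Proof.
move=> yCr; have y0 := root_chord_unique dC rC r0 yCr.
by rewrite /cross r0 ltn0 y0.
Qed.

Lemma component_disjoint x : x \in C :\ r -> x \notin A ->
  [disjoint A & component (C :\ r) x].
Proof.
move=> xCr xA; apply/pred0P => z /=; apply: contraNF xA.
rewrite !in_component xCr /= => /andP[/andP[_ az] /andP[_ xz]].
by apply: connect_trans az _; rewrite cross_in_sym.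
Qed.

Lemma component_no_cross x y z : x \in C :\ r -> x \notin A ->
  y \in A -> z \in component (C :\ r) x -> ~~ cross y z.
Proof.
move=> xCr xA yA zB; apply: contraFN (disjointFr (component_disjoint xCr xA) yA) => yz.
move: yA zB; rewrite !in_component => /andP[yCr _] /andP[zCr xz].
rewrite yCr; apply: connect_trans xz (connect1 _).
by rewrite /cross_in /= crossC yCr zCr yz.
Qed.

(* A component other than A must cross the root, so it has points on both     *)
(* sides of r.2; if x and z enclosed y, it would interleave with A.           *)
Lemma component_gap (x y z : 'I_n.+2.*2) :
  x \notin endpoints A -> z \notin endpoints A -> 0 < x -> x < y -> y < z ->
  y \notin endpoints A.
Proof.
move=> xA zA x0 xy yz; apply/negP => yA.
have sub X : component (C :\ r) X \subset C.
  exact: subset_trans (component_sub _ _) (subsetDl _ _).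
have no_interleave X u v : X \in C :\ r -> X \notin A ->
    u \in endpoints (component (C :\ r) X) -> v \in endpoints (component (C :\ r) X) ->
    1 < u -> u < y -> y < v -> False.
  move=> XCr XA uB vB u1 uy yv; rewrite -a1 in u1.
  have [c cA [d dB cd]] := interleave_cross dC sAC (sub X)
    (component_disjoint XCr XA) conA (component_connected XCr) a_in uB yA vB u1 uy yv.
  by rewrite (negPf (component_no_cross XCr XA cA dB)) in cd.
have yr : y != r.2 :> nat by apply: contraNneq r2_out => /val_inj <-.
have endp X Y : Y \in component (C :\ r) X ->
   (Y.1 \in endpoints (component (C :\ r) X)) /\ (Y.2 \in endpoints (component (C :\ r) X)).
  by move=> YB; rewrite !inE !imset_f // orbT.
have owner v : v \notin endpoints A -> 0 < v -> v != r.2 ->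
    exists X, [/\ X \in C :\ r, X \notin A & v \in endpoints (component (C :\ r) X)].
  move=> vA v0 vr; have [X XC vX] := chord_diagram_cover v dC.
  have XCr : X \in C :\ r.
    rewrite !inE XC andbT; apply: contraTneq vX => ->; rewrite negb_or vr andbT.
    by apply: contraTneq v0 => ->; rewrite r0.
  exists X; split=> //; first by rewrite -(endpoints_owner dC sAC XC vX).
  by apply/endpointsP; exists X; rewrite // in_component XCr connect0.
have lt1 v : v \notin endpoints A -> 0 < v -> 1 < v.
  move=> vA v0; rewrite ltn_neqAle v0 andbT; apply: contraNneq vA => v1.
  by have -> : v = a.1 by apply: val_inj; rewrite /= a1.
have [ltyr|ltry|/eqP] := ltngtP y r.2; last by rewrite (negPf yr).
  have xr : x != r.2 by apply: contraTneq xy => ->; rewrite -leqNgt ltnW.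
  have [X [XCr XA xX]] := owner x xA x0 xr.
  have [Y YB Yr] := component_cross conC rC XCr.
  have [_ Y2] := endp _ _ YB.
  have YCr := subsetP (component_sub _ _) _ YB.
  have [_ /andP[_ ltr]] := cross_rootE YCr Yr.
  by apply: no_interleave XCr XA xX Y2 (lt1 _ xA x0) xy (ltn_trans ltyr ltr).
have zr : z != r.2 by apply: contraTneq yz => ->; rewrite -leqNgt ltnW.
have [X [XCr XA zX]] := owner z zA (ltn_trans x0 (ltn_trans xy yz)) zr.
have [Y YB Yr] := component_cross conC rC XCr.
have [Y1 _] := endp _ _ YB.
have YCr := subsetP (component_sub _ _) _ YB.
have [Y0 /andP[ltY _]] := cross_rootE YCr Yr.
apply: (no_interleave X _ _ XCr XA Y1 zX _ (ltn_trans ltY ltry) yz).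
apply: lt1 Y0; rewrite (endpoints_owner dC sAC (c := Y)) ?eqxx //; last by case/setD1P: YCr.
by rewrite (disjointFl (component_disjoint XCr XA)).
Qed.

(** Each remaining component crosses the root, so the root holds them together. *)
Lemma connected_rest : connected (C :\: A).
Proof.
have to_root x : x \in C :\: A -> connect (cross_in (C :\: A)) x r.
  rewrite inE => /andP[xA xC]; have [->|nxr] := eqVneq x r; first exact: connect0.
  have xCr : x \in C :\ r by rewrite !inE nxr.
  have [y yB yr] := component_cross conC rC xCr.
  have sub : component (C :\ r) x \subset C :\: A.
    apply/subsetP => z zB; rewrite inE (disjointFl (component_disjoint xCr xA)) //=.
    exact: (subsetP (subset_trans (component_sub _ _) (subsetDl _ _)) _ zB).
  apply: (@connect_trans _ _ y).
    apply: connect_cross_sub sub _; apply: connect_component => //.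
    by move: yB; rewrite in_component => /andP[].
  have rS : r \in C :\: A by rewrite in_setD rA rC.
  by apply: connect1; rewrite /cross_in /= yr (subsetP sub _ yB) rS.
apply/forall_inP => x xS; apply/forall_inP => y yS.
by apply: connect_trans (to_root x xS) _; rewrite cross_in_sym to_root.
Qed.

End Decomposition.

Lemma insert_of_endpoints n (C A : {set chord n.+2}) (i : 'I_n.+1) (q : 'I_i.*2.+1) :
  rccd C -> A \subset C -> connected A -> connected (C :\: A) ->
  (forall v : 'I_n.+2.*2, (v \notin endpoints A) =
    ((v == 0 :> nat) || (q.+1 < v < q.+1 + (n - i).+1.*2))) ->
  exists D C', [/\ rccd D, rccd C' & C = insert q D C'].
Proof.
move=> /and3P[_ dC _] sAC conA conCA endE.
have in_outer v : v \in endpoints A -> exists x, v = outer q x.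
  move=> vA; case: (outer_or_inner q v) => // /innerP.
  by rewrite -endE vA.
have in_inner v : v \notin endpoints A -> exists x, v = inner q x.
  by rewrite endE => /innerP.
pose D := [set c | map_chord (outer q) c \in C].
pose C' := [set c | map_chord (inner q) c \in C].
have DE : map_chord (outer q) @: D = A.
  apply/setP => c; apply/imsetP/idP => [[x]|cA].
    rewrite inE => xC ->; rewrite -(endpoints_owner dC sAC xC (v := outer q x.1)) ?eqxx //.
    rewrite -[_ \in _]negbK endE; apply/innerP => -[y /eqP].
    by rewrite outer_inner.
  have c1 : c.1 \in endpoints A by rewrite inE imset_f.
  have c2 : c.2 \in endpoints A by rewrite inE imset_f ?orbT.
  have [[x xE] [y yE]] := (in_outer _ c1, in_outer _ c2).
  exists (x, y); last by rewrite /map_chord /= -xE -yE -surjective_pairing.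
  by rewrite inE /map_chord /= -xE -yE -surjective_pairing (subsetP sAC).
have CE : map_chord (inner q) @: C' = C :\: A.
  apply/setP => c; rewrite in_setD; apply/imsetP/andP => [[x]|[cA cC]].
    rewrite inE => xC ->; split=> //.
    rewrite -(endpoints_owner dC sAC xC (v := inner q x.1)) ?eqxx //.
    by rewrite endE; apply/innerP; exists x.1.
  have c1 : c.1 \notin endpoints A by rewrite (endpoints_owner dC sAC cC) ?eqxx.
  have c2 : c.2 \notin endpoints A by rewrite (endpoints_owner dC sAC cC) ?eqxx ?orbT.
  have [[x xE] [y yE]] := (in_inner _ c1, in_inner _ c2).
  exists (x, y); last by rewrite /map_chord /= -xE -yE -surjective_pairing.
  by rewrite inE /map_chord /= -xE -yE -surjective_pairing.
have CI : C = insert q D C' by rewrite /insert DE CE -{1}(setIidPr sAC) setID.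
have := dC; rewrite {1}CI chord_diagram_insert => /andP[dD dC'].
exists D, C'; split=> //; apply/and3P; split=> //.
  by rewrite -(connected_map (@ltn_outer _ _ q)) DE.
by rewrite -(connected_map (@ltn_inner _ _ q)) CE.
Qed.

Lemma insert_exists n (C : {set chord n.+2}) : rccd C ->
  exists (i : 'I_n.+1) (q : 'I_i.*2.+1) D C', [/\ rccd D, rccd C' & C = insert q D C'].
Proof.
move=> rcC; have /and3P[_ dC conC] := rcC; have cardC := card_chord_diagram dC.
have [r rC r0] := root_chord dC; have [a aCr a1] := second_chord rcC rC r0.
pose A := component (C :\ r) a.
have sACr : A \subset C :\ r by apply: component_sub.
have sAC : A \subset C by apply: subset_trans sACr (subsetDl _ _).
have aA : a \in A by rewrite in_component aCr connect0.
have rA : r \notin A by apply/negP => /(subsetP sACr); rewrite !inE eqxx.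
have [r1A r2A] : r.1 \notin endpoints A /\ r.2 \notin endpoints A.
  by rewrite !(endpoints_owner dC sAC rC) ?eqxx ?orbT.
have gap := component_gap rcC rC r0 aCr a1; rewrite -/A in gap.
have cardA := card_endpoints dC sAC.
have A_gt0 : 0 < #|A| by rewrite (cardD1 a) aA.
have A_le : #|A| <= n.+1.
  by move: (subset_leq_card sACr); move: cardC; rewrite (cardsD1 r) rC add1n => -[->].
have [y yA yr] := component_cross conC rC aCr; rewrite -/A in yA.
have [_ /andP[_ r2y]] := cross_rootE rcC rC r0 (subsetP sACr _ yA) yr.
have y2A : y.2 \in endpoints A by rewrite inE imset_f ?orbT.
pose P (v : 'I_n.+2.*2) := (0 < v) && (v \notin endpoints A).
have Pr2 : P r.2.
  by rewrite /P r2A andbT; apply: leq_trans (chord_diagram_lt dC rC).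
case: (arg_minnP (fun v : 'I_n.+2.*2 => val v) Pr2) => g /andP[g0 gA] gmin.
have g1 : 1 < g.
  rewrite ltn_neqAle g0 andbT; apply: contraNneq gA => g1.
  have -> : g = a.1 by apply: val_inj; rewrite /= a1.
  by rewrite inE imset_f.
have gy : g < y.2 by apply: leq_ltn_trans r2y; apply: gmin.
(* The points 1, ..., g - 1 and [y.2], which lies beyond g, are endpoints of A. So the gap is
   interior to D, as the range of q requires. *)
have g_le : g <= #|A|.*2.
  rewrite -cardA; apply: (@leq_trans #|y.2 |: [set v : 'I_n.+2.*2 | 1 <= v < g]|).
    rewrite cardsU1 inE [_ < g]ltnNge (ltnW gy) andbF card_ord_interval ?(ltnW (ltn_ord g)) //.
    by rewrite add1n subn1 prednK.
  apply/subset_leq_card/subsetP => v; rewrite in_setU1 => /orP[/eqP->//|].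
  rewrite inE => /andP[v0 vg]; apply: contraTT vg => vA.
  by rewrite -leqNgt; apply: gmin; rewrite /P v0.
have i_lt : #|A|.-1 < n.+1 by rewrite prednK.
pose i := Ordinal i_lt.
have q_lt : g.-2 < i.*2.+1.
  suff aux x k : 1 < x -> x <= k.*2 -> 0 < k -> x.-2 < k.-1.*2.+1 by apply: aux.
  by clear; lia.
(* The last point of D before the gap has number [q.+1] in the insertion and g - 1 here, whence q =
   g - 2. *)
exists i, (Ordinal q_lt); apply: (insert_of_endpoints rcC sAC).
- exact: component_connected.
- exact: connected_rest.
set m2 := (n - i).+1.*2.
have gq : (Ordinal q_lt).+1 = g.-1 by rewrite /=; case: (val g) g1 => [|[]].
rewrite gq; set h := g.-1 + m2.
have hE : h = g.-1 + (n.+2.*2 - #|A|.*2).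
  suff aux k : 0 < k -> k <= n.+1 -> (n - k.-1).+1 = n.+2 - k by rewrite /h /m2 -doubleB /= aux.
  by clear; lia.
have m2_gt0 : 0 < m2 by [].
have h_le : h <= n.+2.*2.
  suff aux x k : x <= k.*2 -> k <= n.+1 -> x.-1 + (n.+2.*2 - k.*2) <= n.+2.*2.
    by rewrite hE aux.
  by clear; lia.
pose S := [set v : 'I_n.+2.*2 | (v == 0 :> nat) || (g.-1 < v < h)].
suff TS : ~: endpoints A = S by move=> v; rewrite -in_setC TS inE.
have SE : S = r.1 |: [set v : 'I_n.+2.*2 | g <= v < h].
  apply/setP => v; rewrite !inE prednK //; congr (_ || _).
  by rewrite -r0.
have cardS : #|S| = m2.
  rewrite SE cardsU1 inE r0 leqNgt g0 /= card_ord_interval //.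
  suff aux x : 0 < x -> 1 + (x.-1 + m2 - x) = m2 by apply: aux.
  by move: m2_gt0; clear; lia.
have cardT : #|~: endpoints A| = m2.
  by rewrite cardsCs setCK card_ord cardA; move: hE; rewrite /h => /addnI.
(* If a point from h on is off A, then [gap] shows that S is contained in the complement of the
   endpoints; otherwise the complement is contained in S. Either way the equal cardinalities
   conclude. *)
have [/existsP[v /andP[vA hv]]|far] := boolP [exists v, (v \notin endpoints A) && (h <= v)].
  apply/esym/eqP; rewrite eqEcard cardS cardT leqnn andbT SE.
  apply/subsetP => w; rewrite in_setC in_setU1 inE => /orP[/eqP-> //|/andP[gw wh]].
  have [/val_inj <- //|ngw] := eqVneq (val g) w.
  by apply: (gap g w v gA vA g0 _ (leq_trans wh hv)); rewrite ltn_neqAle ngw.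
apply/eqP; rewrite eqEcard cardS cardT leqnn andbT.
apply/subsetP => w; rewrite in_setC => wA; rewrite inE prednK //.
have [//|w0] := eqVneq (val w) 0; apply/andP; split.
  by apply: gmin; rewrite /P lt0n w0.
rewrite ltnNge; apply: contra far => hw; apply/existsP; exists w.
by rewrite wA.
Qed.

(** The insertion alone thus determines which points are outer, and from these i and q are
    recovered. *)
Lemma component_insert n (i : 'I_n.+1) (q : 'I_i.*2.+1) D C :
  rccd D -> rccd C ->
  exists x a, [/\ x \in insert q D C, x.1 = 0 :> nat, a \in insert q D C,
    a.1 = 1 :> nat & forall v : 'I_n.+2.*2,
      (v \in endpoints (component (insert q D C :\ x) a)) =
      ((0 < v <= q.+1) || (q.+1 + (n - i).+1.*2 <= v))].
Proof.
move=> rcD rcC; have /and3P[_ dD conD] := rcD; have /and3P[_ dC _] := rcC.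
have [[r rC r0] [a aD a0]] := (root_chord dC, root_chord dD).
exists (map_chord (inner q) r), (map_chord (outer q) a).
rewrite inner_in_insert outer_in_insert /= r0 a0 (insert_root q D C r).
rewrite component_setUl ?imset_f //; first last.
- by rewrite connected_map //; apply: ltn_outer.
- exact: no_cross_outer_inner.
split=> // v; apply/endpointsP/outerP => [[_ /imsetP[c cD ->]]|[x ->]].
  by case/orP => /eqP ->; [exists c.1|exists c.2].
have [c cD xc] := chord_diagram_cover x dD; exists (map_chord (outer q) c).
  exact: imset_f.
by rewrite /= !(inj_eq (e_inj (@ltn_outer _ _ q))).
Qed.

Lemma insert_gap_unique n (i i' : 'I_n.+1) (q : 'I_i.*2.+1) (q' : 'I_i'.*2.+1) D C D' C' :
  rccd D -> rccd C -> rccd D' -> rccd C' -> insert q D C = insert q' D' C' ->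
  i = i' /\ q = q' :> nat.
Proof.
move=> rcD rcC rcD' rcC' eqI.
have [x [a [xI x0 aI a1 endA]]] := component_insert q rcD rcC.
have [y [b [yI y0 bI b1]]] := component_insert q' rcD' rcC'.
have dI : chord_diagram (insert q D C).
  by rewrite chord_diagram_insert; case/and3P: rcD => _ -> _; case/and3P: rcC.
rewrite -eqI in yI bI *.
have -> : b = a by apply: (chord_diagram_fst_inj dI) => //; apply: val_inj; rewrite /= a1.
have -> : y = x by apply: (chord_diagram_fst_inj dI) => //; apply: val_inj; rewrite /= x0.
move=> endA'.
have eqv k : k < n.+2.*2 -> ((0 < k <= q.+1) || (q.+1 + (n - i).+1.*2 <= k)) =
    ((0 < k <= q'.+1) || (q'.+1 + (n - i').+1.*2 <= k)).
  by move=> lek; have := endA (Ordinal lek); rewrite endA'.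
suff aux N j k j' k' : j <= N -> j' <= N -> k <= j.*2 -> k' <= j'.*2 ->
    (forall v, v < N.+2.*2 -> ((0 < v <= k.+1) || (k.+1 + (N - j).+1.*2 <= v)) =
      ((0 < v <= k'.+1) || (k'.+1 + (N - j').+1.*2 <= v))) -> j = j' /\ k = k'.
  have [||||//|ij ->] := aux n i q i' q'.
  - by rewrite -ltnS.
  - by rewrite -ltnS.
  - by rewrite -ltnS.
  - by rewrite -ltnS.
  - by split=> //; apply: val_inj.
clear => lejN lej'N lek lek' eqv.
(* Comparing at the first point of each inner block gives k = k'; comparing just past the end of
   each gives j = j'. *)
have E1 := eqv k.+2; have E2 := eqv k'.+2; have E3 := eqv (k.+1 + (N - j).+1.*2).
have E4 := eqv (k'.+1 + (N - j').+1.*2); clear eqv.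
have kk : k = k' by lia.
by split=> //; subst k'; lia.
Qed.

Lemma insert_inj n (i : 'I_n.+1) (q : 'I_i.*2.+1) D C D' C' :
  insert q D C = insert q D' C' -> D = D' /\ C = C'.
Proof.
move=> eqI; split; apply/setP => c.
  by rewrite -(outer_in_insert q D C) eqI outer_in_insert.
by rewrite -(inner_in_insert q D C) eqI inner_in_insert.
Qed.

(** Insertion is a bijection: [insert_exists] gives surjectivity, [insert_gap_unique] disjointness
    over the pairs (i, q), and [insert_inj] injectivity for each pair. *)
Lemma rccd_sum (R : nmodType) n (F : {set chord n.+2} -> R) :
  (\sum_(C | rccd C) F C =
   \sum_(i < n.+1) \sum_(q < i.*2.+1)
     \sum_(D : {set chord i.+1} | rccd D)
       \sum_(C : {set chord (n - i).+1} | rccd C) F (insert q D C))%R.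
Proof.
pose pairs (i : 'I_n.+1) :=
  [set p : {set chord i.+1} * {set chord (n - i).+1} | rccd p.1 && rccd p.2].
pose im (i : 'I_n.+1) (q : 'I_i.*2.+1) := [set insert q p.1 p.2 | p in pairs i].
have imP i q C : C \in im i q -> exists D C', [/\ rccd D, rccd C' & C = insert q D C'].
  by case/imsetP => -[D C']; rewrite inE => /andP[rcD rcC'] ->; exists D, C'.
transitivity (\sum_(i < n.+1) \sum_(q < i.*2.+1) \sum_(C in im i q) F C)%R; last first.
  apply: eq_bigr => i _; apply: eq_bigr => q _; rewrite big_imset /=; last first.
    by move=> [D C] [D' C'] _ _ /= /insert_inj[-> ->].
  by rewrite pair_big; apply: eq_bigl => p; rewrite inE.
transitivity (\sum_(C in \bigcup_(i < n.+1) \bigcup_(q < i.*2.+1) im i q) F C)%R.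
  apply: eq_bigl => C; apply/idP/bigcupP => [rcC|[i _ /bigcupP[q _ /imP]]].
    have [i [q [D [C' [rcD rcC' CE]]]]] := insert_exists rcC.
    exists i => //; apply/bigcupP; exists q => //; apply/imsetP.
    by exists (D, C'); rewrite // inE rcD.
  move=> [D [C' [rcD rcC' ->]]]; have /and3P[_ /root_chord[r rC r0] _] := rcC'.
  exact: (rccd_insert q rcD rcC' rC r0).
rewrite partition_disjoint_bigcup => [|i i' nii'].
  apply: eq_bigr => i _; rewrite partition_disjoint_bigcup // => q q' nqq'.
  apply/pred0P => C /=; apply: contra_neqF nqq' => /andP[/imP[D [C1 [rcD rcC1 ->]]]].
  move=> /imP[D' [C1' [rcD' rcC1' eqI]]]; apply: val_inj.
  by have [] := insert_gap_unique rcD rcC1 rcD' rcC1' eqI.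
apply/pred0P => C /=; apply: contra_neqF nii'.
move=> /andP[/bigcupP[q _ /imP[D [C1 [rcD rcC1 ->]]]]].
move=> /bigcupP[q' _ /imP[D' [C1' [rcD' rcC1' eqI]]]].
by have [] := insert_gap_unique rcD rcC1 rcD' rcC1' eqI.
Qed.

(** * The weight of an insertion *)

Section FlagLabels.
Implicit Types (s : seq bool) (l : seq nat).

(** Both b(C) and f_C depend only on the word recording terminality along the intersection order; on
    such words insertion is essentially concatenation. *)
Definition flag_labels s := mask s (iota 1 (size s)).

Definition label_gaps l := pairmap (fun x y => y - x) (head 0 l) (behead l).

Lemma mask_iota_addn k a m s :
  mask s (iota (k + a) m) = map (addn k) (mask s (iota a m)).
Proof. by rewrite map_mask -iotaDl. Qed.

Lemma flag_labels_cat s s' :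
  flag_labels (false :: s ++ s') =
  map S (flag_labels s) ++ map (addn (size s)) (mask s' (iota 2 (size s'))).
Proof.
rewrite /flag_labels /= size_cat iotaD mask_cat ?size_iota //.
by rewrite (addnC 2) (mask_iota_addn _ 2) (mask_iota_addn 1 1).
Qed.

Lemma pairmap_subn_addn k x l :
  pairmap (fun x y => y - x) (k + x) (map (addn k) l) = pairmap (fun x y => y - x) x l.
Proof. by elim: l x => //= y l IHl x; rewrite IHl subnDl. Qed.

Lemma flag_labels_last s : last false s ->
  exists x l, flag_labels s = x :: l /\ last x l = size s.
Proof.
case/lastP: s => [//|s b]; rewrite last_rcons => ->.
rewrite /flag_labels size_rcons -(addn1 (size s)) iotaD add1n /= cats1 mask_rcons ?size_iota //=.
rewrite cats1 addn1; case: (mask _ _) => [|x l]; first by exists (size s).+1, [::].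
by exists x, (rcons l (size s).+1); rewrite last_rcons.
Qed.

Lemma size_flag_labels s : size (flag_labels s) <= size s.
Proof. by rewrite size_mask ?size_iota // count_size. Qed.

Section Weight.
Variables (K : fieldType) (f : nat -> K).
Local Open Scope ring_scope.

Definition flag_weight s : K :=
  f 0 ^+ (size s - size (label_gaps (flag_labels s)) - 1) *
  \prod_(d <- label_gaps (flag_labels s)) f d.

(* The labels of the second block follow those of the first, the last of which *)
(* is terminal; so the gap created between the two blocks is b - 1, where b is *)
(* the first label of the second block.                                        *)
Lemma flag_weight_cat s s' t :
  last false s -> last false t -> t = (s' == [::]) :: s' ->
  head 0 (flag_labels (false :: s ++ s')) = (head 0 (flag_labels s)).+1 /\
  flag_weight (false :: s ++ s') =
    flag_weight s * flag_weight t * f (head 0 (flag_labels t) - 1)%N.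
Proof.
move=> /flag_labels_last[x [l [sE lE]]] last_t tdef; have := size_flag_labels s.
rewrite /flag_weight flag_labels_cat sE /= => size_l; split=> //.
(* When the second diagram is a single chord, it adds a nonterminal letter and no gap, hence one
   factor [f 0]; this is f (b - 1) with b = 1. *)
have [s'0|s'0] := eqVneq s' [::].
  rewrite tdef s'0 /= !cats0 /flag_labels /label_gaps /= -[S]/(addn 1) pairmap_subn_addn.
  rewrite big_nil expr0 !mulr1 mulrAC -exprSr size_pairmap.
  by congr (f 0 ^+ _ * _); move: size_l; clear; lia.
have tE : flag_labels t = mask s' (iota 2 (size s')) by rewrite tdef (negPf s'0).
have [y [l' [tE' _]]] := flag_labels_last last_t.
have size_t := size_flag_labels t; rewrite -tE tE' /= in size_t *.
rewrite /label_gaps /= pairmap_cat /= -[S]/(addn 1) pairmap_subn_addn last_map lE.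
rewrite pairmap_subn_addn size_cat /= !size_pairmap big_cat big_cons /= size_cat.
have -> : (size s + y - (1 + size s) = y - 1)%N by clear; lia.
rewrite /= !size_pairmap; have tS : size t = (size s').+1 by rewrite tdef.
have -> : (1 + (size s + size s') - (size l + (size l').+1) - 1 =
    (size s - size l - 1) + (size t - size l' - 1))%N.
  by move: tS size_l size_t; clear; lia.
by rewrite exprD; ring.
Qed.

End Weight.
End FlagLabels.

Definition flags n (C : {set chord n}) : seq bool :=
  map (terminal C) (intersection_order C).

Lemma size_flags n (C : {set chord n}) : chord_diagram C -> size (flags C) = n.
Proof. by move=> dC; rewrite size_map size_intersection_order. Qed.

Lemma terminal_labelsE n (C : {set chord n}) :
  chord_diagram C -> terminal_labels C = flag_labels (flags C).
Proof.
move=> dC; rewrite /terminal_labels filter_mask map_mask -/(flags C) /flag_labels size_map.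
congr mask; set s := intersection_order C.
have us : uniq s by apply: intersection_rec_uniq (chord_diagram_fst_inj dC) (leqnn _).
have [[c cs]|s0] : (exists c, c \in s) \/ s = [::].
  by case: (s) => [|c l]; [right|left; exists c; rewrite mem_head].
  apply: (@eq_from_nth _ 0) => [|k]; rewrite size_map ?size_iota // => ks.
  by rewrite (nth_map c) //= nth_iota // index_uniq.
by rewrite s0.
Qed.

Lemma flags_root n (C : {set chord n.+1}) : rccd C -> exists s, flags C = (s == [::]) :: s.
Proof.
move=> rcC; have /and3P[_ dC conC] := rcC; have [r rC r0] := root_chord dC.
have := size_flags dC.
rewrite /flags (intersection_order_root dC rC r0) /= (terminal_root rcC rC r0).
set s := map _ _ => -[size_s]; exists s; congr (_ :: _).
by rewrite -size_eq0 size_s eqSS.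
Qed.

Lemma flags_insert n (i : 'I_n.+1) (q : 'I_i.*2.+1) D C :
  rccd D -> rccd C -> flags (insert q D C) = false :: flags D ++ behead (flags C).
Proof.
move=> rcD rcC; have /and3P[_ dC _] := rcC; have [r rC r0] := root_chord dC.
exact: (terminal_flags_insert q rcD rcC rC r0).
Qed.

(** The last chord of an insertion is the last chord of the inner diagram, or that of the outer one
    when the inner diagram is only a root. *)
Lemma last_flags n (C : {set chord n}) : rccd C -> last false (flags C).
Proof.
elim/ltn_ind: n C => -[|[|n]] IH C rcC; first by case/andP: rcC.
  have [s sE] := flags_root rcC; have := size_flags (C := C).
  case/and3P: rcC => _ dC _ => /(_ dC); rewrite sE /= => -[/size0nil ->].
  by [].
have [i [q [D [C' [rcD rcC' ->]]]]] := insert_exists rcC.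
rewrite flags_insert //=; have := IH _ _ C' rcC'; have := IH _ _ D rcD.
have [s ->] := flags_root rcC'; rewrite /= last_cat.
rewrite !ltnS !leq_subr => /(_ (ltn_ord i)) lastD /(_ isT).
by case: s.
Qed.

Section DiagramWeight.
Variables (K : fieldType) (f : nat -> K).
Local Open Scope ring_scope.

Lemma fdiagE n (C : {set chord n}) : chord_diagram C -> fdiag f C = flag_weight f (flags C).
Proof.
move=> dC; rewrite /fdiag /flag_weight size_flags //.
by rewrite /gaps /bdiag terminal_labelsE.
Qed.

Lemma bdiagE n (C : {set chord n}) :
  chord_diagram C -> bdiag C = head 0%N (flag_labels (flags C)).
Proof. by move=> dC; rewrite /bdiag terminal_labelsE. Qed.

Lemma insert_weight n (i : 'I_n.+1) (q : 'I_i.*2.+1) D C : rccd D -> rccd C ->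
  bdiag (insert q D C) = (bdiag D).+1 /\
  fdiag f (insert q D C) = fdiag f D * fdiag f C * f (bdiag C - 1)%N.
Proof.
move=> rcD rcC; have [/and3P[_ dD _] /and3P[_ dC _]] := (rcD, rcC).
have dI : chord_diagram (insert q D C) by rewrite chord_diagram_insert dD.
rewrite !bdiagE // !fdiagE // flags_insert //.
have [s sE] := flags_root rcC; have last_s := last_flags rcC.
by rewrite sE /=; apply: flag_weight_cat (last_flags rcD) _ erefl; rewrite -sE.
Qed.

Lemma bdiag_size1 (C : {set chord 1}) : rccd C -> bdiag C = 1%N /\ fdiag f C = 1.
Proof.
move=> rcC; have /and3P[_ dC _] := rcC.
have [s sE] := flags_root rcC; have := size_flags dC; rewrite sE => -[/size0nil s0].
rewrite bdiagE // fdiagE // sE s0; split=> //.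
by rewrite /flag_weight /flag_labels /label_gaps /= big_nil mulr1.
Qed.

Lemma bdiag_gt0 n (C : {set chord n}) : rccd C -> (0 < bdiag C)%N.
Proof.
move=> rcC; have /and3P[_ dC _] := rcC; rewrite bdiagE //.
have [x [l [E _]]] := flag_labels_last (last_flags rcC); rewrite E /=.
have : x \in flag_labels (flags C) by rewrite E mem_head.
by move/mem_mask; rewrite mem_iota => /andP[].
Qed.

End DiagramWeight.

Local Open Scope ring_scope.

(** * Generating series *)

Lemma chord_diagram1 : chord_diagram [set ((@ord0 1, @ord_max 1) : chord 1)].
Proof.
apply/andP; split; first by apply/forall_inP => c; rewrite inE => /eqP->.
apply/forallP => p; apply/cards1P; exists (@ord0 1, @ord_max 1).
apply/setP => c; rewrite !inE; case: eqP => [->|//] /=.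
by case: p => -[|[|//]] lt.
Qed.

Lemma rccd1 (C : {set chord 1}) : rccd C = (C == [set ((@ord0 1, @ord_max 1) : chord 1)]).
Proof.
apply/idP/eqP => [/and3P[_ dC _]|->].
  have [r rC r0] := root_chord dC.
  have /cards1P[c cE] : #|C| == 1%N by rewrite card_chord_diagram.
  move: (rC); rewrite cE inE => /eqP <-; congr [set _].
  have := chord_diagram_lt dC rC; have := ltn_ord r.2; rewrite r0 => r2 r2_gt0.
  rewrite [r]surjective_pairing; congr (_, _); apply: val_inj => //=.
  by move: (val r.2) r2 r2_gt0 => [|[|]].
rewrite /rccd chord_diagram1 /=; apply/forall_inP => c; rewrite inE => /eqP->.
by apply/forall_inP => d; rewrite inE => /eqP->; apply: connect0.
Qed.

(** * The operator delta and the identity Psi Gam = x *)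

Section Euler.
Variable K : fieldType.
Implicit Types p q g : {poly K}.

Definition euler_shift p : {poly K} := 'X * p^`() *+ 2 - p.

Definition euler_lift g p : {poly K} := g * euler_shift p.

Lemma coef_euler_shift p j : (euler_shift p)`_j = p`_j *+ j *+ 2 - p`_j.
Proof.
rewrite coefB coefMn coefXM coef_deriv.
by case: j => [|j] //=; rewrite mulr0n.
Qed.

(** Pascal's rule, in the form of the product rule for Taylor coefficients of exponential series. *)
Lemma sum_binS (V : nmodType) (F : nat -> nat -> V) N :
  \sum_(n < N.+2) F n (N.+1 - n)%N *+ 'C(N.+1, n) =
  \sum_(n < N.+1) (F n.+1 (N - n)%N + F n (N - n).+1) *+ 'C(N, n).
Proof.
rewrite big_ord_recl /= bin0 subn0 mulr1n.
under eq_bigr do rewrite subSS binS mulrnDr.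
rewrite big_split /= addrA addrC; under [RHS]eq_bigr do rewrite mulrnDl.
rewrite [RHS]big_split /=; congr (_ + _).
transitivity (\sum_(n < N.+2) F n (N.+1 - n)%N *+ 'C(N, n)).
  by rewrite [RHS]big_ord_recl /= bin0 subn0 mulr1n.
rewrite big_ord_recr /= bin_small // mulr0n addr0.
by apply: eq_bigr => n _; rewrite subSn // -ltnS.
Qed.

(* The Leibniz rule turns the sum for N.+1 into the image under              *)
(* p |-> 2 g (x p' - p) of the sum for N, and this kills 'X.                  *)
Lemma euler_convolution g N :
  \sum_(n < N.+1) (iter n (euler_lift g) 1 * iter (N - n) (euler_lift g) 'X) *+ 'C(N, n) =
  'X *+ (N == 0%N).
Proof.
pose E p : {poly K} := g * (('X * p^`() - p) *+ 2).
have E_sum N' (h : 'I_N' -> {poly K}) : E (\sum_n h n) = \sum_n E (h n).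
  by rewrite /E raddf_sum mulr_sumr -sumrB -sumrMnl mulr_sumr.
have E_muln p k : E (p *+ k) = E p *+ k.
  rewrite /E derivMn [_ * (_ *+ k)]mulrnAr -mulrnBl.
  by rewrite mulrnAC -mulrnAr.
elim: N => [|N IHN]; first by rewrite big_ord1 /= mul1r.
rewrite (sum_binS (fun n k => iter n (euler_lift g) 1 * iter k (euler_lift g) 'X)).
transitivity (E ('X *+ (N == 0%N))); last first.
  by rewrite E_muln /E derivX mulr1 subrr mul0rn mulr0 mul0rn.
rewrite -IHN E_sum; apply: eq_bigr => n _; rewrite E_muln; congr (_ *+ _).
rewrite /= /E /euler_lift /euler_shift derivM.
by move: (iter n _ _) (iter (N - n) _ _) => p q; ring.
Qed.

End Euler.

(** * Recursions for the diagram sums *)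

Section DiagramSums.
Variables (K : fieldType) (f : nat -> K).
Implicit Types (h : nat -> K).

(** With an arbitrary function h of b(C), one recursion serves both Phi_b and g_n: insertion
    replaces h by its shift. *)
Definition diagram_sum h n : K :=
  \sum_(C : {set chord n} | rccd C) fdiag f C * h (bdiag C).

(* phi b and gsum n are Phi_b and g_n. *)
Definition phi b := diagram_sum (fun t => (t == b)%:R).
Definition gsum n := diagram_sum (fun t => if (n <= t)%N then f (t - n)%N else 0).

Lemma diagram_sum0 h : diagram_sum h 0 = 0.
Proof. by rewrite /diagram_sum big_pred0. Qed.

Lemma diagram_sum1 h : diagram_sum h 1 = h 1%N.
Proof.
rewrite /diagram_sum (eq_bigl _ _ rccd1) big_pred1_eq.
have [->->] : bdiag [set ((@ord0 1, @ord_max 1) : chord 1)] = 1%N /\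
    fdiag f [set ((@ord0 1, @ord_max 1) : chord 1)] = 1.
  by apply: bdiag_size1; rewrite rccd1.
by rewrite mul1r.
Qed.

Lemma eq_diagram_sum h1 h2 n :
  (forall b, 0 < b -> h1 b = h2 b)%N -> diagram_sum h1 n = diagram_sum h2 n.
Proof.
by move=> h12; apply: eq_bigr => C rcC; rewrite h12 // bdiag_gt0.
Qed.

Lemma diagram_sum_phi h n : diagram_sum h n = \sum_(k < n) phi k.+1 n * h k.+1.
Proof.
under eq_bigr do rewrite /phi /diagram_sum mulr_suml.
rewrite exchange_big /=; apply: eq_bigr => C rcC.
have b0 := bdiag_gt0 rcC; have /and3P[_ dC _] := rcC; have bn := bdiag_le dC.
have lt : ((bdiag C).-1 < n)%N by rewrite prednK.
rewrite (bigD1 (Ordinal lt)) //= prednK // eqxx mulr1 big1 ?addr0 // => k nk.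
have -> : (bdiag C == k.+1) = false.
  apply: contraNF nk => /eqP b; apply/eqP/val_inj => /=.
  by rewrite b.
by rewrite mulr0 mul0r.
Qed.

Lemma phi_eq0 b n : (n < b)%N -> phi b n = 0.
Proof.
move=> lt; apply: big1 => C /and3P[_ /bdiag_le le _].
by rewrite ltn_eqF ?mulr0 // (leq_ltn_trans le).
Qed.

(* The factor i.*2.+1 is the number 2 |D| - 1 of gaps. *)
Lemma diagram_sum_insert h n :
  diagram_sum h n.+2 =
  \sum_(i < n.+1) (diagram_sum (h \o S) i.+1 *+ i.*2.+1) * gsum 1 (n - i).+1.
Proof.
rewrite /diagram_sum rccd_sum; apply: eq_bigr => i _.
rewrite mulrnAl -[X in _ = _ *+ X]card_ord -sumr_const; apply: eq_bigr => q _.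
rewrite mulr_suml; apply: eq_bigr => D rcD; rewrite mulr_sumr; apply: eq_bigr => C rcC.
by have [-> ->] := insert_weight f q rcD rcC; rewrite bdiag_gt0 //=; ring.
Qed.

Section Truncation.
Variable M : nat.

(** Working with polynomials that are exact below x^M replaces power series in x. *)
Definition g1 : {poly K} := \poly_(j < M) gsum 1 j.

(** The single chord contributes the term in [h 1], insertions contribute g_1 delta. As g_1 has no
    constant term, only the coefficients of p below n matter. *)
Lemma coef_lift_diagram_sum h (p : {poly K}) n : (n < M)%N ->
  (forall j, (j < n)%N -> p`_j = diagram_sum (h \o S) j) ->
  diagram_sum h n = (euler_lift g1 p)`_n + h 1%N *+ (n == 1)%N.
Proof.
move=> ltnM pE.
have coefG j : (j < M)%N -> g1`_j = gsum 1 j by move=> lt; rewrite coef_poly lt.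
case: n ltnM pE => [|[|n]] ltnM pE.
- rewrite diagram_sum0 /euler_lift coefM big_ord1 coefG //.
  by rewrite /gsum diagram_sum0 mul0r mulr0n addr0.
- rewrite diagram_sum1 /euler_lift coefM big_ord_recl big_ord1 /= coefG ?(ltnW ltnM) //.
  rewrite /gsum diagram_sum0 mul0r add0r subnn coef_euler_shift pE //.
  by rewrite diagram_sum0 mul0rn subr0 mulr0 add0r mulr1n.
rewrite mulr0n addr0 /euler_lift mulrC coefM big_ord_recl big_ord_recr /=.
rewrite subnn (coefG 0%N) ?(leq_ltn_trans _ ltnM) // /gsum diagram_sum0 mulr0 addr0.
rewrite coef_euler_shift pE // diagram_sum0 mul0rn subr0 mul0r add0r.
rewrite diagram_sum_insert; apply: eq_bigr => i _.
have -> : (n.+2 - bump 0 i = (n - i).+1)%N.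
  by have := ltn_ord i; rewrite /bump; move: (val i); clear => k; lia.
rewrite coefG; last by apply: leq_ltn_trans ltnM; rewrite ltnS leqW ?leq_subr.
rewrite coef_euler_shift pE; last exact: (ltn_ord i).
congr (_ * _).
by rewrite -mulrnA muln2 doubleS [in RHS]mulrSr addrK.
Qed.

Lemma coef_phi k j : (j < M)%N -> (iter k (euler_lift g1) 'X)`_j = phi k.+1 j.
Proof.
elim: k j => [|k IHk] j ltjM; rewrite /phi; last first.
  rewrite (coef_lift_diagram_sum (p := iter k (euler_lift g1) 'X)) // ?mul0rn ?addr0 //.
  by move=> i lt_ij; rewrite IHk // (ltn_trans lt_ij).
rewrite (coef_lift_diagram_sum (p := 0)) //.
  by rewrite /euler_lift /euler_shift linear0 mulr0 mul0rn subr0 mulr0 coef0 add0r coefX.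
(* No insertion has b(C) = 1, so Phi_1 is just x. *)
move=> i _; rewrite coef0 (eq_diagram_sum (h2 := fun=> 0)) => [|[|b]] //.
by rewrite /diagram_sum big1 // => C _; rewrite mulr0.
Qed.

(** The sign comes from delta 1 = - 1; the iterates starting from 1 are thus the Taylor coefficients
    of Gam. *)
Lemma coef_gsum n j : (j < M)%N -> (iter n.+1 (euler_lift g1) 1)`_j = - gsum n.+1 j.
Proof.
elim: n j => [|n IHn] j ltjM.
  by rewrite /= /euler_lift /euler_shift derivC mulr0 mul0rn sub0r mulrN1 coefN coef_poly ltjM.
rewrite /gsum (coef_lift_diagram_sum (p := - iter n.+1 (euler_lift g1) 1)) //.
  rewrite mul0rn addr0 [in RHS]/euler_lift /euler_shift derivN.
  by rewrite mulrN mulNrn -opprD mulrN coefN opprK.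
by move=> i lt_ij; rewrite coefN IHn ?opprK // (ltn_trans lt_ij).
Qed.

End Truncation.

End DiagramSums.

(** * The inverse operator *)

Section Operators.
Variables (K : fieldType) (V : lmodType K).
Implicit Types (h : nat -> V) (H : nat -> nat -> V) (g : nat -> nat -> K).

Lemma iter_drho_scale n (a : K) h m :
  iter n (@drho K V) (fun m => a *: h m) m = a *: iter n (@drho K V) h m.
Proof. by elim: n m => [//|n IHn] m /=; rewrite /drho IHn scalerMnr. Qed.

Lemma iter_drho_fact n h m :
  iter n (@drho K V) h m *+ m`! = h (m + n)%N *+ (m + n)`!.
Proof.
elim: n m => [|n IHn] m /=; first by rewrite addn0.
by rewrite /drho -mulrnA -factS IHn addSnnS.
Qed.

(** The operator is unitriangular for the degree in x. *)
Lemma Gop_inj g H1 H2 : xdivisible g ->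
  (forall j, Gop g H1 j =1 Gop g H2 j) -> forall j, H1 j =1 H2 j.
Proof.
move=> g0 eqG j; elim/ltn_ind: j => j IHj m.
by have := eqG j m; rewrite /Gop (dop_ext g0 IHj) => /addIr.
Qed.

Lemma sum_antidiagonal j (c : nat -> nat -> K) (D : nat -> V) :
  (forall n k, (j < n + k)%N -> c n k = 0) ->
  \sum_(n < j.+1) \sum_(k < j.+1) c n k *: D (n + k)%N =
  \sum_(N < j.+1) (\sum_(n < N.+1) c n (N - n)%N) *: D N.
Proof.
move=> c0.
have inner_sum (n : 'I_j.+1) : \sum_(k < j.+1) c n k *: D (n + k)%N =
    \sum_(N < j.+1 | (n <= N)%N) c n (N - n)%N *: D N.
  rewrite -(big_mkord xpredT (fun k => c n k *: D (n + k)%N)).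
  rewrite -(big_mkord (fun N => n <= N)%N (fun N => c n (N - n)%N *: D N)).
  rewrite (big_cat_nat (n := (j.+1 - n)%N)) ?leq_subr //= [X in _ + X]big_nat.
  rewrite [X in _ + X]big1 ?addr0 => [|k /andP[lek _]]; last first.
    by rewrite c0 ?scale0r // -leq_subLR.
  rewrite -(big_nat_widenl _ _ _ xpredT) // -[X in _ = \big[_/_]_(X <= _ < _ | _) _]add0n [RHS]big_addn.
  by apply: eq_bigr => k _; rewrite addnK addnC.
under eq_bigr do rewrite inner_sum.
rewrite (exchange_big_dep xpredT) //=; apply: eq_bigr => N _.
rewrite scaler_suml (big_ord_widen _ (fun n => c n (N - n)%N *: D N) (ltn_ord N)).
by apply: eq_bigl => n; rewrite ltnS.
Qed.
End Operators.

(** * The explicit inverse and its value at rho = 0 *)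

Section Solution.
Variables (K : fieldType) (f : nat -> K).
Hypothesis charK0 : [pchar K] =i pred0.

Lemma fact_neq0 n : n`!%:R != 0 :> K.
Proof. by move/pcharf0P: charK0 => ->; rewrite -lt0n fact_gt0. Qed.

Lemma gsum_eq0 n j : (j < n)%N -> gsum f n j = 0.
Proof.
move=> lt; apply: big1 => C /and3P[_ /bdiag_le le _].
by rewrite leqNgt (leq_ltn_trans le lt) mulr0.
Qed.

Lemma gammaE n j : gamma f n j = (-1) ^+ n / n`!%:R * gsum f n j.
Proof.
rewrite /gamma /gsum /diagram_sum big_mkcondr; congr (_ * _); apply: eq_bigr => C _.
by case: ifP => _; rewrite ?mulr0.
Qed.

Local Notation Dker n := (iter n (@drho K {poly K}) (kernelF f)).

(** The index [j.+1] accounts for the division of Phi_(k+1) by x. The signs of (- L)^k vanish since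
    L stands for - d/drho, and terms with k > j are zero. *)
Definition solution j m : {poly K} :=
  \sum_(k < j.+1) (phi f k.+1 j.+1 / k`!%:R) *: Dker k m.

Lemma solution_widen n j m :
  (n >= j)%N -> solution j m = \sum_(k < n.+1) (phi f k.+1 j.+1 / k`!%:R) *: Dker k m.
Proof.
move=> le_jn; rewrite /solution.
rewrite (big_ord_widen _ (fun k => (phi f k.+1 j.+1 / k`!%:R) *: Dker k m) (le_jn : j < n.+1)%N).
rewrite big_mkcond; apply: eq_bigr => k _; case: ifP => // /negbT.
by rewrite -leqNgt => lt; rewrite phi_eq0 ?mul0r ?scale0r.
Qed.

Lemma iter_drho_solution n N j m : (j <= N)%N ->
  iter n (@drho K {poly K}) (solution j) m =
  \sum_(k < N.+1) (phi f k.+1 j.+1 / k`!%:R) *: Dker (n + k)%N m.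
Proof.
move=> le_jN; rewrite (iter_drho_ext _ (fun m => solution_widen m le_jN)).
rewrite iter_drho_sum; apply: eq_bigr => k _.
by rewrite iter_drho_scale iterD.
Qed.

(** Since (-1)^n gamma_n = g_n / n!, the operator is Gam(d/drho), and the identity is Psi Gam = x
    read at x^(j+1). *)
Lemma Gop_solution j m :
  Gop (gamma f) solution j m = xconst (kernelF f) j m.
Proof.
pose Q n := iter n (euler_lift (g1 f j.+2)) 1.
pose P k := iter k (euler_lift (g1 f j.+2)) 'X.
have P_coef k i : (i <= j.+1)%N -> (P k)`_i = phi f k.+1 i by move=> le_i; rewrite /P coef_phi.
have Q_coef n i : (i <= j.+1)%N -> (Q n.+1)`_i = - gsum f n.+1 i by move=> le_i; rewrite /Q coef_gsum.
have conv N : \sum_(n < N.+1) (Q n * P (N - n)%N) *+ 'C(N, n) = 'X *+ (N == 0%N).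
  exact: euler_convolution.
have Q0 : Q 0%N = 1 by [].
clearbody Q P; pose c n k : K := (Q n * P k)`_j.+1 / (n`! * k`!)%:R.
(* Q_n is divisible by x^n and P_k by x^(k+1), up to the truncation. *)
have c0 n k : (j < n + k)%N -> c n k = 0.
  move=> lt; rewrite /c coefM big1 ?mul0r // => i _.
  have le_ij : (i <= j.+1)%N := ltn_ord i.
  have [lt_in|le_ni] := ltnP i n.
    case: n lt lt_in => // n _ lt_in.
    by rewrite Q_coef // gsum_eq0 // oppr0 mul0r.
  rewrite P_coef ?leq_subr // phi_eq0 ?mulr0 //.
  by move: le_ij le_ni lt; move: (val i); clear; lia.
transitivity (\sum_(n < j.+1) \sum_(k < j.+1) c n k *: Dker (n + k)%N m).
  rewrite /Gop big_ord_recl; congr (_ + _).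
    apply: eq_bigr => k _; rewrite /c Q0 mul1r P_coef // mul1n.
    by [].
  rewrite /dop /xsum big_add1 big_mkord -sumrN; apply: eq_bigr => n _.
  rewrite /xscale.
  under eq_bigr do rewrite (iter_drho_solution _ _ (leq_subr _ _)) scaler_sumr.
  rewrite exchange_big -sumrN; apply: eq_bigr => k _.
  under eq_bigr do rewrite scalerA.
  rewrite -scaler_suml -scaleNr; congr (_ *: _).
  rewrite /c coefM [X in _ = X / _]big_ord_recr /= subnn P_coef // phi_eq0 // mulr0 addr0.
  rewrite mulr_suml -sumrN; apply: eq_bigr => i _.
  rewrite Q_coef ?(ltnW (ltn_ord i)) // P_coef ?leq_subr //.
  have le_ij : (i <= j)%N := ltn_ord i.
  have -> : bump 0 n = n.+1 by [].
  rewrite gammaE natrM invfM subSn // !mulrA -exprMn mulrNN mulr1 expr1n mul1r.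
  by rewrite !mulNr; congr (- _); ring.
rewrite (sum_antidiagonal (fun N => Dker N m) c0).
(* Dividing [conv] by N! turns the binomial coefficient into 1 / (n! (N - n)!). *)
have cE N : \sum_(n < N.+1) c n (N - n)%N = ((N == 0%N) && (j == 0%N))%:R.
  have := congr1 (fun p : {poly K} => p`_j.+1 / N`!%:R) (conv N).
  rewrite coefMn coefX coef_sum mulr_suml.
  have -> : (j.+1 == 1%N)%:R *+ (N == 0%N) / N`!%:R = ((N == 0%N) && (j == 0%N))%:R :> K.
    by case: N => [|N] /=; rewrite ?mulr0n ?mul0r // fact0 divr1 mulr1n eqSS.
  move=> <-; apply: eq_bigr => n _; rewrite /c coefMn -(bin_fact (ltn_ord n : n <= N)%N).
  rewrite -[_ *+ 'C(N, n)]mulr_natr -mulrA; congr (_ * _).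
  rewrite (natrM _ 'C(N, n)) invfM mulrA divff ?mul1r //.
  have := fact_neq0 N; rewrite -(bin_fact (ltn_ord n : n <= N)%N) natrM.
  by apply: contraNneq => ->; rewrite mul0r.
under eq_bigr do rewrite cE.
rewrite big_ord_recl /= big1 ?addr0 => [|N _]; last by rewrite scale0r.
by case: (j) => [|j'] /=; rewrite ?scale1r ?scale0r.
Qed.

Lemma Gop_inv_solution j m :
  Gop_inv (gamma f) (xconst (kernelF f)) j m = solution j m.
Proof.
have g0 := gamma_xdivisible f.
by apply: (Gop_inj g0) => {}j {}m; rewrite Gop_invK // Gop_solution.
Qed.

Lemma coef_expm1 m l : (expm1 K m)`_l = ((0 < m)%N && (l == m))%:R * ((-1) ^+ l / l`!%:R).
Proof.
case: m => [|m]; first by rewrite coef0 mul0r.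
rewrite /expm1 -scaleN1r exprZn !coefZ coefXn /=.
by case: eqP => [->|_]; rewrite ?mulr0 ?mul0r // mulr1 mul1r mulrC.
Qed.

Lemma coef_kernelF k l : (kernelF f k)`_l =
  (if (0 < l <= k.+1)%N then f (k.+1 - l)%N else 0) * ((-1) ^+ l / l`!%:R).
Proof.
rewrite coef_sum; under eq_bigr do rewrite coefZ coef_expm1 (mulrA (f _)).
rewrite -mulr_suml; congr (_ * _).
have [/andP[l0 lk]|out] := ifP; last first.
  apply: big1 => i _; case: andP => [[i0 /eqP lE]|_]; last by rewrite mulr0.
  by move: out; rewrite lE i0 leq_subr.
have lt : (k.+1 - l < k.+2)%N by rewrite ltnS leq_subr.
rewrite (bigD1 (Ordinal lt)) //= subKn // l0 eqxx mulr1 big1 ?addr0 // => i ne_i.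
case: andP => [[i0 /eqP lE]|_]; last by rewrite mulr0.
by case/eqP: ne_i; apply: val_inj; rewrite /= lE subKn // ltnW // -subn_gt0.
Qed.

(** At rho = 0 the k-th derivative is k! times the coefficient of rho^k, which cancels the 1 / k!;
    grouping diagrams by b(C) = k + 1 then gives g_l. *)
Lemma coef_solution j l : (solution j 0)`_l = if (0 < l)%N then gamma f l j.+1 else 0.
Proof.
rewrite coef_sum; under eq_bigr => k _.
  rewrite coefZ -[Dker k 0%N]mulr1n -[1%N]fact0 iter_drho_fact add0n coefMn.
  rewrite -[_`_l *+ _]mulr_natl mulrA divfK ?fact_neq0 // coef_kernelF mulrA.
  over.
rewrite -mulr_suml; case: ltnP => [l0|_]; last by rewrite big1 ?mul0r // => k _; rewrite mulr0.
rewrite gammaE mulrC /gsum diagram_sum_phi; congr (_ * _).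
Qed.

End Solution.

Theorem theorem4p13 (K : fieldType) (charK0 : [pchar K] =i pred0) (f : nat -> K) :
  forall j l : nat, green (gamma f) j l = (dse_rhs f (gamma f) j)`_l.
Proof.
move=> [|j] l; rewrite /green /dse_rhs coefB /=.
  by rewrite coef1 coef0; case: l => [|l] //; rewrite gamma_xdivisible.
rewrite coef0 (Gop_inv_solution f charK0) coef_solution //.
by case: l.
Qed.
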